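(* Let $k\ge 0$ be an integer and let $G$ be a $k$-$\{1,2\}$-factor-critical graph. Suppose that there exists an edge $e\in E(G)$ such that $G-e$ is not a $k$-$\{1,2\}$-factor-critical graph. Then: (i) if $k=0$ and $G$ is planar, then $k+1\le\delta(G)\le k+3$; (ii) if $k>0$ and $G$ is $k$-planar, then $k+1\le\delta(G)\le k+2$.
   Context: All graphs are finite, undirected and simple; $\delta(G)$ denotes the minimum degree of $G$. A $\{1,2\}$-factor of a graph $G$ is a spanning subgraph each of whose components is a regular graph of degree one or two (i.e. a single edge or a cycle). A graph $G$ of order $n$ is $k$-$\{1,2\}$-factor-critical (where $0\le k<n$) if for every set $T\subseteq V(G)$ with $|T|=k$, the graph $G-T$ has a $\{1,2\}$-factor. A graph $G$ is $k$-planar if $G-S$ is planar for every $S\subseteq V(G)$ with $|S|=k$. *)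

(* Defs.v *)
From mathcomp Require Import all_boot all_order all_algebra.
From mathcomp Require Import classical_sets set_interval reals topology normedtype.

Set Implicit Arguments.
Unset Strict Implicit.
Unset Printing Implicit Defensive.

Import numFieldNormedType.Exports.

Record sgraph := SGraph {
  vertex :> finType;
  adj : rel vertex;
  adj_sym : symmetric adj;
  adj_irr : irreflexive adj }.

(* An edge is the unordered pair of its ends, as a two-element vertex set. *)
Definition edges (G : sgraph) : {set {set G}} :=
  [set e : {set G} | [exists x, exists y, adj x y && (e == [set x; y])]].

Definition degree (G : sgraph) (x : G) : nat := #|[set y | adj x y]|.

(* Degrees are smaller than #|G|, so for nonempty G the default value #|G| of
   the iterated minimum is never attained. *)
Definition min_degree (G : sgraph) : nat := \big[minn/#|G|]_(x : G) degree x.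

Definition regular (d : nat) (G : sgraph) : Prop := forall x : G, degree x = d.

Section Subgraphs.
Variable G : sgraph.

Definition induced_adj (A : {set G}) : rel {x : G | x \in A} :=
  fun x y => adj (val x) (val y).

Lemma induced_adj_sym A : symmetric (@induced_adj A).
Proof. by move=> x y; exact: adj_sym. Qed.

Lemma induced_adj_irr A : irreflexive (@induced_adj A).
Proof. by move=> x; exact: adj_irr. Qed.

Definition induced (A : {set G}) : sgraph :=
  SGraph (@induced_adj_sym A) (@induced_adj_irr A).

Definition delete_vertices (T : {set G}) : sgraph := induced (~: T).

(* The spanning subgraph of G with edge set edges G :&: F; every spanning
   subgraph of G is obtained in this way. *)
Definition spanning_adj (F : {set {set G}}) : rel G :=
  fun x y => adj x y && ([set x; y] \in F).

Lemma spanning_adj_sym F : symmetric (spanning_adj F).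
Proof. by move=> x y; rewrite /spanning_adj adj_sym finset.setUC. Qed.

Lemma spanning_adj_irr F : irreflexive (spanning_adj F).
Proof. by move=> x; rewrite /spanning_adj adj_irr. Qed.

Definition spanning (F : {set {set G}}) : sgraph :=
  SGraph (@spanning_adj_sym F) (@spanning_adj_irr F).

Definition delete_edge (e : {set G}) : sgraph := spanning (edges G :\ e).

Definition component (x : G) : sgraph :=
  induced [set y | connect (@adj G) x y].

End Subgraphs.

Definition is_12_factor (G : sgraph) (F : {set {set G}}) : Prop :=
  forall x : spanning F, exists2 d : nat, d \in [:: 1; 2] & regular d (component x).

Definition has_12_factor (G : sgraph) : Prop :=
  exists2 F : {set {set G}}, F \subset edges G & is_12_factor F.

Definition factor_critical (k : nat) (G : sgraph) : Prop :=
  k < #|G| /\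
  forall T : {set G}, #|T| = k -> has_12_factor (delete_vertices T).

Section Planarity.
Variable R : realType.
Local Open Scope ring_scope.

(* Crossing-free drawing of G in the plane R * R: the vertex x is drawn as the
   point p x, the edge e as the simple arc c e, parametrized by [0, 1]. *)
Definition plane_drawing (G : sgraph) (p : G -> R * R)
    (c : {set G} -> R -> R * R) : Prop :=
  [/\ injective p,
      forall e : {set G}, e \in edges G ->
        [/\ {within `[0, 1], continuous (c e)}%classic,
            {in `[0, 1] &, injective (c e)} &
            exists x y : G, [/\ e = [set x; y], c e 0 = p x & c e 1 = p y]],
      forall (e : {set G}) (x : G) (t : R), e \in edges G -> t \in `]0, 1[ -> c e t <> p x &
      forall (e f : {set G}) (s t : R), e \in edges G -> f \in edges G -> e != f ->
        s \in `]0, 1[ -> t \in `]0, 1[ -> c e s <> c f t].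

Definition planar (G : sgraph) : Prop :=
  exists (p : G -> R * R) (c : {set G} -> R -> R * R), plane_drawing p c.

Definition k_planar (k : nat) (G : sgraph) : Prop :=
  forall S : {set G}, #|S| = k -> planar (delete_vertices S).

End Planarity.

(* Main.v *)
Require Import Defs.
From mathcomp Require Import all_boot all_order all_algebra zify ring lra.
From mathcomp Require Import boolp reals topology normedtype.
From mathcomp Require classical_sets.

Set Implicit Arguments.
Unset Strict Implicit.
Unset Printing Implicit Defensive.
Import GRing.Theory.

(* If H has no {1,2}-factor, Hall's theorem for the bipartite double cover of H
   (a perfect matching there is a permutation of the vertices along edges, whose
   cycles form a factor) yields a set S' with more than |S'| isolated vertices in
   H - S'. For H = (G - e) - T this gives disjoint sets S, I with
   |I| = |S| - k + 1 such that every edge at I other than e ends in S, so at least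
   delta(G) |I| - 2 edges join I to S. Removing the k vertices of S with fewest
   neighbours in I leaves a planar bipartite graph, whose number of edges is at
   most 2 |V| - 4; this contradicts a large delta(G).

   The bound 2 |V| - 4 for a topologically planar graph avoids the Jordan curve
   theorem: covering a drawing by a fine mesh exhibits the graph as a minor of a
   square grid. The grid has an abstract dual over F_2 (its cycles are exactly the
   coboundaries of sets of faces), and so have its minors. For a bipartite graph
   with an abstract dual every nonzero coboundary of a face has at least four
   edges, and each edge lies in at most two of them; as the coboundaries of faces
   span the cycle space and sum to zero, comparing dimensions gives the bound. *)

(** * Abstract duals over F_2 *)

(** Edges form a type of their own so that chains can be indexed by it. The orientation given by
    [src] and [tgt] is bookkeeping that boundaries over F_2 do not see. *)
Record multigraph := Multigraph {
  vert : finType;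
  edge : finType;
  src : edge -> vert;
  tgt : edge -> vert }.

Section Chains.
Variable M : multigraph.
Local Open Scope ring_scope.
Implicit Types (z : edge M -> 'F_2) (A : {set vert M}).

Lemma addF2 (x : 'F_2) : x + x = 0.
Proof. by case: x => [[|[|//]] ?]; apply/val_inj. Qed.

Lemma F2_cancel (x y : 'F_2) : x + y = 0 -> x = y.
Proof. by move=> xy; rewrite -[x]addr0 -(addF2 y) addrA xy add0r. Qed.

Definition bdry z (v : vert M) : 'F_2 :=
  \sum_e z e * ((src e == v)%:R + (tgt e == v)%:R).

Definition cycle_chain z := forall v, bdry z v = 0.

Definition csupp z : {set edge M} := [set e | z e != 0].

Lemma eq_bdry z z' v : z =1 z' -> bdry z v = bdry z' v.
Proof. by move=> zz'; apply: eq_bigr => e _; rewrite zz'. Qed.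

Lemma bdryD z z' v : bdry (fun e => z e + z' e) v = bdry z v + bdry z' v.
Proof. by rewrite -big_split; apply: eq_bigr => e _; rewrite mulrDl. Qed.

Lemma bdry_sum (I : finType) (c : I -> 'F_2) (Z : I -> edge M -> 'F_2) v :
  bdry (fun e => \sum_i c i * Z i e) v = \sum_i c i * bdry (Z i) v.
Proof.
rewrite /bdry; under eq_bigr do rewrite mulr_suml.
rewrite exchange_big; apply: eq_bigr => i _ /=.
by rewrite mulr_sumr; apply: eq_bigr => e _; rewrite mulrA.
Qed.

Lemma bdry_delta e v :
  bdry (fun f => (f == e)%:R) v = (src e == v)%:R + (tgt e == v)%:R.
Proof.
rewrite /bdry (bigD1 e) //= eqxx mul1r big1 ?addr0 // => f /negbTE ->.
by rewrite mul0r.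
Qed.

Definition link A : rel (vert M) := fun u v =>
  [&& u \in A, v \in A &
      [exists e, ((src e == u) && (tgt e == v)) || ((src e == v) && (tgt e == u))]].

Lemma link_sym A : symmetric (link A).
Proof.
move=> u v; rewrite /link andbCA; do 2!congr (_ && _).
by apply: eq_existsb => e; rewrite orbC.
Qed.

Definition connected_set A := {in A &, forall u v, connect (link A) u v}.

(** In the F_2 sum of the edges of a path the inner vertices cancel and only the two ends remain in
    the boundary. *)
Lemma connect_chain A u v : connect (link A) u v ->
  exists2 z, (forall e, z e != 0 -> (src e \in A) && (tgt e \in A)) &
             forall w, bdry z w = (u == w)%:R + (v == w)%:R.
Proof.
case/connectP => p; elim: p u => [|u' p IHp] u /= => [_ ->|].
  exists (fun=> 0) => [e|w]; first by rewrite eqxx.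
  by rewrite addF2 /bdry big1 // => e _; rewrite mul0r.
case/andP=> /and3P[uA u'A /existsP[e he]] /IHp{}IH /IH[z zA dz].
exists (fun f => (f == e)%:R + z f) => [f|w].
  have [->|_] := eqVneq f e; last by rewrite add0r => /zA.
  by case/orP: he => /andP[/eqP-> /eqP->]; rewrite uA u'A.
rewrite bdryD bdry_delta dz addrA; congr (_ + _).
case/orP: he => /andP[/eqP-> /eqP->]; first by rewrite -addrA addF2 addr0.
by rewrite addrAC addF2 add0r.
Qed.

(** The elements of [F] act as faces and [l e], [r e] as the two sides of [e]. This is Whitney's
    combinatorial duality: cycles are exactly the cuts of the graph joining [l e] to [r e]. *)
Definition abstract_dual (F : finType) (l r : edge M -> F) := forall z,
  cycle_chain z <-> exists a : F -> 'F_2, forall e, z e = a (l e) + a (r e).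

Definition has_dual := exists (F : finType) (l r : edge M -> F), abstract_dual l r.

End Chains.

(** * Abstract duals pass to minors *)

Section Minor.
Variables (M N : multigraph) (U : vert N -> {set vert M}) (b : vert N -> vert M).
Variable rep : edge N -> edge M.
Local Open Scope ring_scope.
Hypotheses (bU : forall x, b x \in U x) (Uconn : forall x, connected_set (U x)).
Hypothesis Udisj : forall x y v, v \in U x -> v \in U y -> x = y.
Hypothesis rep_ends : forall e,
  (src (rep e) \in U (src e)) && (tgt (rep e) \in U (tgt e)) ||
  (src (rep e) \in U (tgt e)) && (tgt (rep e) \in U (src e)).
Hypotheses (rep_inj : injective rep) (loopless : forall e : edge N, src e != tgt e).

(** In passing from [M] to its minor [N] the inner edges are contracted, the edges [rep e] survive,
    and all others are deleted. *)
Let inner (g : edge M) := [exists x, (src g \in U x) && (tgt g \in U x)].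

Let rep_inner e : ~~ inner (rep e).
Proof.
apply/negP => /existsP[x /andP[sx tx]].
case/orP: (rep_ends e) => /andP[s' t'].
  by have := loopless e; rewrite -(Udisj sx s') -(Udisj tx t') eqxx.
by have := loopless e; rewrite -(Udisj sx s') -(Udisj tx t') eqxx.
Qed.

Let mem_branch e f : ((src (rep e) \in U f) + (tgt (rep e) \in U f) =
  (src e == f) + (tgt e == f))%N.
Proof.
have mem v x : v \in U x -> (v \in U f) = (x == f).
  by move=> vx; apply/idP/eqP => [/(Udisj vx)|<-].
by case/orP: (rep_ends e) => /andP[/mem-> /mem->] //; rewrite addnC.
Qed.

(* An even edge set of N lifts to one of M by closing it up inside the branch sets. *)
Let lift_cycle z : cycle_chain (M := N) z ->
  exists2 z' : edge M -> 'F_2, cycle_chain z' &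
    (forall e, z' (rep e) = z e) /\
    (forall g, z' g != 0 -> inner g \/ exists e, g = rep e).
Proof.
move=> cz.
(* [We] links the ends of [rep e] to the base points of the two branch sets, so that [rep e] plus
   [We] has exactly these base points as boundary. *)
pose closing e (We : edge M -> 'F_2) :=
  (forall g, We g != 0 -> inner g) /\
  forall w, bdry We w = (src (rep e) == w)%:R + (tgt (rep e) == w)%:R +
    ((b (src e) == w)%:R + (b (tgt e) == w)%:R).
have [|W HW] := boolp.choice (P := closing).
  move=> e.
  have sub x (z0 : edge M -> 'F_2) :
      (forall g, z0 g != 0 -> (src g \in U x) && (tgt g \in U x)) ->
      forall g, z0 g != 0 -> inner g.
    by move=> z0x g /z0x gx; apply/existsP; exists x.
  have key x y u v : u \in U x -> v \in U y -> exists We : edge M -> 'F_2,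
      (forall g, We g != 0 -> inner g) /\
      forall w, bdry We w = (u == w)%:R + (v == w)%:R +
        ((b x == w)%:R + (b y == w)%:R).
    move=> ux vy; have [z1 /sub z1x dz1] := connect_chain (Uconn ux (bU x)).
    have [z2 /sub z2y dz2] := connect_chain (Uconn vy (bU y)).
    exists (fun g => z1 g + z2 g); split=> [g|w]; last first.
      by rewrite bdryD dz1 dz2 addrACA.
    by have [->|/z1x//] := eqVneq (z1 g) 0; rewrite add0r => /z2y.
  case/orP: (rep_ends e) => /andP[/key k1 /k1]//.
  move=> [We [Wi dW]]; exists We; split=> // w; rewrite dW; congr (_ + _).
  by rewrite addrC.
pose z' g := \sum_e z e * ((g == rep e)%:R + W e g).
exists z' => [w|].
  rewrite bdry_sum; under eq_bigr => e _.
    rewrite bdryD bdry_delta (HW e).2 addrA addF2 add0r; over.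
  (* Grouping by base points turns the boundary of [z'] at [w] into a sum of boundaries of [z], all
     zero. *)
  rewrite /= (eq_bigr (fun e =>
    \sum_x (b x == w)%:R * (z e * ((src e == x)%:R + (tgt e == x)%:R)))).
    rewrite exchange_big /= big1 // => x _; rewrite -mulr_sumr.
    by have := cz x; rewrite /bdry => ->; rewrite mulr0.
  move=> e _; rewrite (bigD1 (src e)) //= (bigD1 (tgt e)) /=; last by rewrite eq_sym loopless.
  rewrite big1 ?addr0 => [|x /andP[/negbTE xs /negbTE xt]]; last first.
    by rewrite ![_ == x]eq_sym xs xt addr0 !mulr0.
  rewrite !eqxx [tgt e == src e]eq_sym (negbTE (loopless e)) addr0 add0r !mulr1.
  by rewrite mulrDr; congr (_ + _); rewrite mulrC.
split=> [e|g gn0].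
  rewrite /z' (bigD1 e) //= eqxx big1 ?addr0.
    have -> : W e (rep e) = 0.
      by apply/eqP; apply: contraNT (rep_inner e) => /(HW e).1.
    by rewrite addr0 mulr1.
  move=> f fe; have -> : W f (rep e) = 0.
    by apply/eqP; apply: contraNT (rep_inner e) => /(HW f).1.
  by rewrite (inj_eq rep_inj) eq_sym (negbTE fe) addr0 mulr0.
have /existsP[e] : [exists e, z e * ((g == rep e)%:R + W e g) != 0].
  apply: contraNT gn0; rewrite negb_exists => /forallP h.
  by rewrite /z' big1 // => e _; apply/eqP; rewrite -[_ == _]negbK; apply: h.
have [->|_] := eqVneq g (rep e); first by right; exists e.
rewrite add0r => h; left; apply: (HW e).1; apply: contraNneq h => ->.
by rewrite mulr0.
Qed.

(** An inner edge has both or neither of its ends in [U x], so it cancels over F_2 and only the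
    edges [rep e] contribute. *)
Let bdry_branch (z' : edge M -> 'F_2) x :
  (forall g, z' g != 0 -> inner g \/ exists e, g = rep e) ->
  \sum_(v in U x) bdry z' v = bdry (M := N) (fun e => z' (rep e)) x.
Proof.
move=> supp; rewrite /bdry exchange_big /=.
have inS g : \sum_(v in U x) z' g * ((src g == v)%:R + (tgt g == v)%:R) =
    z' g * ((src g \in U x) + (tgt g \in U x))%:R.
  have ind u : \sum_(v in U x) (u == v)%:R = (u \in U x)%:R :> 'F_2.
    case: (boolP (u \in U x)) => ux; last first.
      by rewrite big1 // => v vx; case: eqP ux vx => // -> /negbTE->.
    by rewrite (bigD1 u) //= eqxx big1 ?addr0 // => v /andP[_ /negbTE]; rewrite eq_sym => ->.
  by rewrite -mulr_sumr big_split /= !ind natrD.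
under eq_bigr do rewrite inS.
rewrite (bigID (mem (codom rep))) /= addrC big1 ?add0r => [|g gN]; last first.
  have [->|/supp[/existsP[y /andP[sy ty]]|[e ge]]] := eqVneq (z' g) 0.
  - by rewrite mul0r.
  - have -> : (src g \in U x) = (tgt g \in U x).
      by apply/idP/idP => [/(Udisj sy)<-|/(Udisj ty)<-].
    by rewrite natrD addF2 mulr0.
  - by rewrite ge codom_f in gN.
have [e0 _|N0] := pickP (edge N); last first.
  rewrite !big1 // => [e|g /codomP[e]]; by have := N0 e.
rewrite (reindex_onto rep (fun g => odflt e0 [pick e | rep e == g])) /=; last first.
  by move=> g /codomP[e ->]; case: pickP => [f /eqP //|/(_ e)]; rewrite eqxx.
rewrite big_mkcond. apply: eq_bigr => e _; rewrite mem_branch natrD codom_f.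
case: pickP => [f /eqP/rep_inj->|/(_ e)] /=; by rewrite eqxx.
Qed.

(** Deletion in the graph is contraction in the dual and conversely: the two sides of each deleted
    edge are merged, via the classes of [nb], while contracted edges simply drop out. *)
Lemma has_dual_minor : has_dual M -> has_dual N.
Proof.
case=> F [l [r D]].
pose nb : rel F := fun f f' => [exists g, [&& ~~ inner g, g \notin codom rep &
  ((l g == f) && (r g == f')) || ((l g == f') && (r g == f))]].
have nb_sym : connect_sym nb.
  apply: sym_connect_sym => f f'; apply: eq_existsb => g.
  by rewrite [X in [&& _, _ & X]]orbC.
have root_nb f f' : nb f f' -> fingraph.root nb f = fingraph.root nb f'.
  by move=> h; apply/eqP; rewrite (root_connect nb_sym) connect1.
have nb_edge g : ~~ inner g -> g \notin codom rep -> nb (l g) (r g).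
  by move=> ig cg; apply/existsP; exists g; rewrite ig cg !eqxx.
exists F, (fun e => fingraph.root nb (l (rep e))), (fun e => fingraph.root nb (r (rep e))) => z.
split.
  (* The lifted cycle vanishes on deleted edges, so its potential is constant on each class of
     merged faces. *)
  move=> /lift_cycle[z' cz' [z'rep z'supp]].
  have [a Ha] := (D z').1 cz'; exists a => e.
  have a_nb f f' : nb f f' -> a f = a f'.
    case/existsP => g /and3P[ig cg gff'].
    have : z' g = 0.
      apply/eqP; apply: contraT => /z'supp[|[e' ge']]; first by rewrite (negbTE ig).
      by rewrite ge' codom_f in cg.
    by rewrite Ha => /F2_cancel; case/orP: gff' => /andP[/eqP-> /eqP->].
  have a_conn f f' : connect nb f f' -> a f = a f'.
    case/connectP => p; elim: p f => [|f1 p IHp] f /=; first by move=> _ ->.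
    by case/andP=> /a_nb -> /IHp{}IHp /IHp.
  have a_root f : a (fingraph.root nb f) = a f by rewrite (a_conn _ _ (connect_root nb f)).
  by rewrite !a_root -Ha z'rep.
(* Conversely, a potential on merged faces pulls back to a cycle of [M] that vanishes on deleted
   edges; [bdry_branch] restricts it to [N]. *)
case=> a Ha x; pose z' g := a (fingraph.root nb (l g)) + a (fingraph.root nb (r g)).
have cz' : cycle_chain z' by apply/D; exists (fun f => a (fingraph.root nb f)).
rewrite (eq_bdry _ (z' := fun e => z' (rep e))) ?Ha // -bdry_branch.
  by rewrite big1 // => v _; apply: cz'.
move=> g gn0; have [/codomP[e ->]|cg] := boolP (g \in codom rep); first by right; exists e.
left; apply: contraNT gn0 => /nb_edge/(_ cg)/root_nb; rewrite /z' => ->.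
by rewrite addF2.
Qed.

End Minor.

(** * Connected vertex sets *)

Section Connected.
Variable M : multigraph.
Implicit Types A B : {set vert M}.

Lemma connect_linkS A B u v : A \subset B -> connect (link A) u v -> connect (link B) u v.
Proof.
move=> /subsetP AB; apply: connect_sub => x y /and3P[xA yA xy].
by apply: connect1; rewrite /link !AB.
Qed.

Lemma link_connect_sym A : connect_sym (link A).
Proof. exact/sym_connect_sym/link_sym. Qed.

Lemma connected_bigcup (I : finType) (P : pred I) (F : I -> {set vert M}) v :
  (forall i, P i -> connected_set (F i) /\ v \in F i) ->
  connected_set (\bigcup_(i | P i) F i).
Proof.
move=> conn; suff toV u : u \in \bigcup_(i | P i) F i ->
    connect (link (\bigcup_(i | P i) F i)) u v.
  by move=> u w /toV uv /toV; rewrite link_connect_sym; apply: connect_trans.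
case/bigcupP => i Pi ui; have [Fi vi] := conn i Pi.
by apply: connect_linkS (Fi u v ui vi); apply: bigcup_sup.
Qed.

Lemma connected_setU A B v :
  connected_set A -> connected_set B -> v \in A -> v \in B -> connected_set (A :|: B).
Proof.
move=> cA cB vA vB; suff toV u : u \in A :|: B -> connect (link (A :|: B)) u v.
  by move=> u w /toV uv /toV; rewrite link_connect_sym; apply: connect_trans.
case/setUP => uX; first by apply: connect_linkS (cA _ _ uX vA); apply: subsetUl.
by apply: connect_linkS (cB _ _ uX vB); apply: subsetUr.
Qed.

Lemma connected_chain N (A : nat -> {set vert M}) :
  (forall k, (k <= N)%N -> connected_set (A k)) ->
  (forall k, (k < N)%N -> exists2 v, v \in A k & v \in A k.+1) ->
  connected_set (\bigcup_(k < N.+1) A k).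
Proof.
elim: N => [|N IHN] cA meet; first by rewrite big_ord1; apply: cA.
have [v vN vN1] := meet N (ltnSn N).
rewrite big_ord_recr; apply: (@connected_setU _ _ v) => //.
- by apply: IHN => k kN; [apply: cA | apply: meet]; rewrite ltnW.
- exact: cA.
- by apply/bigcupP; exists ord_max.
Qed.

Lemma reachable_connected A u : connected_set [set v | connect (link A) u v].
Proof.
set C := [set v | _].
have toU w v : w \in C -> connect (link A) w v -> connect (link C) w v.
  move=> wC /connectP[p]; elim: p w wC => [|w' p IHp] w wC /=; first by move=> _ ->.
  case/andP=> ww' /IHp{}IHp /IHp.
  have w'C : w' \in C by move: wC; rewrite !inE => /connect_trans; apply; apply: connect1.
  move=> /(_ w'C); apply: connect_trans; apply: connect1.
  by case/and3P: ww' => _ _ e; rewrite /link wC w'C.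
have uC : u \in C by rewrite inE connect0.
move=> v w; rewrite [v \in C]inE [w \in C]inE => /(toU _ _ uC) + /(toU _ _ uC).
by rewrite link_connect_sym; apply: connect_trans.
Qed.

Lemma connect_subset A u v : u \in A -> connect (link A) u v -> v \in A.
Proof.
move=> uA /connectP[p]; elim: p u uA => [|w p IHp] u uA /=; first by move=> _ ->.
by case/andP=> /and3P[_ wA _]; apply: IHp.
Qed.

End Connected.

Lemma connect_crossing (T : finType) (r : rel T) (P : pred T) u w :
  connect r u w -> P u -> ~~ P w -> exists a b, [/\ P a, ~~ P b & r a b].
Proof.
case/connectP=> p; elim: p u => [|v p IHp] u /=; first by move=> _ -> ->.
case/andP=> uv /IHp{}IHp /IHp{}IHp Pu /IHp{}IHp.
by case: (boolP (P v)) => Pv; [apply: IHp | exists u, v].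
Qed.


(** * The edge bound from an abstract dual *)

Section EdgeBound.
Variable M : multigraph.
Local Open Scope ring_scope.

Let V := vert M.
Let E := edge M.

Lemma dual_edge_bound : has_dual M ->
  (forall z : E -> 'F_2, cycle_chain z -> (exists e, z e != 0) ->
     (4 <= #|csupp z|)%N) ->
  (3 <= #|V|)%N -> (#|E| + 4 <= 2 * #|V|)%N.
Proof.
case=> F [l [r D]] girth V3.
pose C f e : 'F_2 := (l e == f)%:R + (r e == f)%:R.
have cC f : cycle_chain (C f).
  by apply/D; exists (fun f' => (f' == f)%:R).
(* Only faces with nonzero coboundary are counted, since the girth hypothesis speaks of nonzero
   cycles. *)
pose Fs := [set f | [exists e, C f e != 0]].
have C0 f e : f \notin Fs -> C f e = 0.
  by rewrite inE negb_exists => /forallP/(_ e); rewrite negbK => /eqP.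
pose B : 'M['F_2]_(#|E|, #|V|) :=
  \matrix_(i, j) ((src (enum_val i) == enum_val j)%:R + (tgt (enum_val i) == enum_val j)%:R).
pose Dm : 'M['F_2]_(#|Fs|, #|E|) := \matrix_(i, j) C (enum_val i) (enum_val j).
(* Each row of the incidence matrix [B] sums to [1 + 1 = 0], so [B] kills the all-ones vector. *)
have rkB : (\rank B <= #|V|.-1)%N.
  have B1 : B *m const_mx 1 = 0 :> 'M_(_, 1).
    apply/matrixP => i j; rewrite !mxE.
    under eq_bigr do rewrite !mxE mulr1.
    rewrite -(big_enum_val (A := predT)
      (fun v => (src (enum_val i) == v)%:R + (tgt (enum_val i) == v)%:R : 'F_2)) /=.
    rewrite big_split /=.
    have ind u : \sum_v (u == v)%:R = 1 :> 'F_2.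
      by rewrite (bigD1 u) //= eqxx big1 ?addr0 // => v /negbTE; rewrite eq_sym => ->.
    by rewrite !ind addF2.
  have := mulmx0_rank_max B1.
  suff -> : \rank (const_mx 1 : 'M['F_2]_(#|V|, 1)) = 1%N by move: V3; lia.
  apply/eqP; rewrite eqn_leq rank_leq_col lt0n mxrank_eq0; apply/eqP => /matrixP.
  have v0 : 'I_#|V| by exists 0%N; apply: leq_trans V3.
  by move=> /(_ v0 ord0); rewrite !mxE => /eqP; rewrite oner_eq0.
have kerB : (kermx B <= Dm)%MS.
  apply/rV_subP => u /sub_kermxP uB.
  pose z e := u 0 (enum_rank e).
  have cz : cycle_chain z.
    move=> v; have /matrixP/(_ 0 (enum_rank v)) := uB; rewrite !mxE => <-.
    rewrite /bdry (big_enum_val (A := predT)) /=; apply: eq_bigr => i _.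
    by rewrite !mxE /z enum_valK enum_rankK.
  have [a Ha] := (D z).1 cz.
  apply/submxP; exists (\row_i a (enum_val i)); apply/rowP => j; rewrite !mxE.
  have -> : u 0 j = z (enum_val j) by rewrite /z enum_valK.
  rewrite Ha; under eq_bigr do rewrite !mxE.
  rewrite -(big_enum_val (A := mem Fs) (fun f => a f * C f (enum_val j))) /=.
  rewrite big_mkcond /= (eq_bigr (fun f => a f * C f (enum_val j))); last first.
    by move=> f _; case: ifPn => // /C0 ->; rewrite mulr0.
  under eq_bigr do rewrite mulrDr.
  have ind u' : \sum_f a f * (u' == f)%:R = a u'.
    rewrite (bigD1 u') //= eqxx mulr1 big1 ?addr0 // => f /negbTE; rewrite eq_sym => ->.
    by rewrite mulr0.
  by rewrite big_split /= !ind.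
have rkD : (#|Fs| > 0)%N -> (\rank Dm <= #|Fs|.-1)%N.
  move=> F0.
  have D1 : const_mx 1 *m Dm = 0 :> 'M_(1, _).
    apply/matrixP => i j; rewrite !mxE.
    under eq_bigr do rewrite !mxE mul1r.
    rewrite -(big_enum_val (A := mem Fs) (fun f => C f (enum_val j))) /=.
    rewrite big_mkcond /= (eq_bigr (fun f => C f (enum_val j))); last first.
      by move=> f _; case: ifPn => // /C0 ->.
    have ind u : \sum_f (u == f)%:R = 1 :> 'F_2.
      by rewrite (bigD1 u) //= eqxx big1 ?addr0 // => v /negbTE; rewrite eq_sym => ->.
    by rewrite big_split /= !ind addF2.
  have := mulmx0_rank_max D1.
  suff -> : \rank (const_mx 1 : 'M['F_2]_(1, #|Fs|)) = 1%N by move: F0; lia.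
  apply/eqP; rewrite eqn_leq rank_leq_row lt0n mxrank_eq0; apply/eqP => /matrixP.
  move=> /(_ ord0 (Ordinal F0)); rewrite !mxE => /eqP; by rewrite oner_eq0.
(* Double counting: a face has at least four edges and an edge at most two sides. *)
have faces : (4 * #|Fs| <= 2 * #|E|)%N.
  have -> : (4 * #|Fs| = \sum_(f in Fs) 4)%N by rewrite sum_nat_const mulnC.
  apply: (@leq_trans (\sum_(f in Fs) \sum_e ((l e == f) + (r e == f)))%N).
    apply: leq_sum => f; rewrite inE => /existsP ef.
    apply: leq_trans (girth _ (cC f) ef) _; rewrite -sum1_card big_mkcond /=.
    apply: leq_sum => e _; rewrite inE /C.
    by case: (l e == f); case: (r e == f); rewrite ?addr0 ?add0r.
  rewrite exchange_big mulnC -sum_nat_const; apply: leq_sum => e _.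
  rewrite big_split /=.
  have ind u : (\sum_(f in Fs) (u == f) <= 1)%N.
    rewrite big_mkcond (bigD1 u) //= eqxx big1 ?addn0; first by case: ifP.
    by move=> f /negbTE; rewrite eq_sym => ->; case: ifP.
  by rewrite (leq_add (ind _) (ind _)).
have := mxrankS kerB; rewrite mxrank_ker => rk.
(* With no faces the cycle space is zero and [|E| <= |V| - 1], which suffices because [3 <= |V|].
   Otherwise [|E| <= (|V| - 1) + (|Fs| - 1)] is combined with [2 |Fs| <= |E|]. *)
case: (posnP #|Fs|) => [F0|/[dup] F0 /rkD rkD'].
  have : (\rank Dm <= 0)%N by have := rank_leq_row Dm; move: F0; lia.
  by move: rk rkB V3; lia.
by move: rk rkB rkD' V3 faces F0; lia.
Qed.

(** Every vertex has even degree in the support, so each edge continues at both ends. Extending [e0]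
    by [e1] at its source, by [e2] at its target, and [e1] by [e3] at its target gives four edges;
    they are distinct because the absence of parallel edges forces [tgt e1 != tgt e0]. *)
Lemma bipartite_girth (A : {set V}) :
  (forall e : E, (src e \in A) && (tgt e \notin A)) ->
  (forall e f : E, src e = src f -> tgt e = tgt f -> e = f) ->
  forall z : E -> 'F_2, cycle_chain z -> (exists e, z e != 0) ->
    (4 <= #|csupp z|)%N.
Proof.
move=> bip simple z cz [e0 z0].
have nst (e f : E) : src e != tgt f.
  by apply/eqP => h; have := bip e; have := bip f; rewrite h => /andP[_ /negbTE->].
have next_src (e : E) : z e != 0 -> exists f : E, [/\ z f != 0, f != e & src f = src e].
  move=> ze; have [f /and3P[zf fe /eqP ef]|none] :=
    pickP (fun f : E => [&& z f != 0, f != e & src f == src e]); first by exists f.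
  suff : bdry z (src e) = z e by rewrite cz => zz; rewrite -zz eqxx in ze.
  rewrite /bdry (bigD1 e) //= eqxx eq_sym (negbTE (nst _ _)) addr0 mulr1.
  rewrite big1 ?addr0 // => f fe; rewrite [tgt f == _]eq_sym (negbTE (nst _ _)) addr0.
  have [zf|zf] := eqVneq (z f) 0; first by rewrite zf mul0r.
  by have := none f; rewrite zf fe /= => ->; rewrite mulr0.
have next_tgt (e : E) : z e != 0 -> exists f : E, [/\ z f != 0, f != e & tgt f = tgt e].
  move=> ze; have [f /and3P[zf fe /eqP ef]|none] :=
    pickP (fun f : E => [&& z f != 0, f != e & tgt f == tgt e]); first by exists f.
  suff : bdry z (tgt e) = z e by rewrite cz => zz; rewrite -zz eqxx in ze.
  rewrite /bdry (bigD1 e) //= eqxx (negbTE (nst _ _)) add0r mulr1.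
  rewrite big1 ?addr0 // => f fe; rewrite (negbTE (nst _ _)) add0r.
  have [zf|zf] := eqVneq (z f) 0; first by rewrite zf mul0r.
  by have := none f; rewrite zf fe /= => ->; rewrite mulr0.
have [e1 [z1 e10 s1]] := next_src _ z0.
have [e2 [z2 e20 t2]] := next_tgt _ z0.
have [e3 [z3 e31 t3]] := next_tgt _ z1.
have t10 : tgt e1 != tgt e0 by apply: contraNneq e10 => /(simple _ _ s1) ->.
have uniq4 : uniq [:: e0; e1; e2; e3].
  rewrite /= !inE !negb_or [e0 == e1]eq_sym e10 [e0 == e2]eq_sym e20 [e1 == e3]eq_sym e31.
  rewrite !andbT /=. apply/and3P; split.
  - by apply: contraNneq t10 => ->; rewrite t3.
  - by apply: contraNneq t10 => ->; rewrite t2.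
  - by apply: contraNneq t10 => e23; rewrite -t2 e23 t3.
apply: (@leq_trans (size [:: e0; e1; e2; e3])) => //.
rewrite -(card_uniqP uniq4); apply/subset_leq_card/subsetP => e.
by rewrite !inE => /or4P[] /eqP->.
Qed.

End EdgeBound.

(** * The dual of a grid *)

Section Grid.
Variable m : nat.
Let n := m.+1.
Local Open Scope ring_scope.

(* The edge [(i, j, h)] leaves [(i, j)] upwards if [h] and to the right otherwise. *)
Definition grid : multigraph := @Multigraph
  ('I_n.+1 * 'I_n.+1)%type ('I_n * 'I_n * bool)%type
  (fun e => (inord e.1.1, inord e.1.2))
  (fun e => (inord (e.1.1 + ~~ e.2), inord (e.1.2 + e.2))).

(* The square with upper right corner [(i, j)]; all outer squares become [(0, 0)]. *)
Definition face (i j : nat) : 'I_n * 'I_n :=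
  if [&& 0 < i, i < n, 0 < j & j < n]%N then (inord i, inord j) else (ord0, ord0).

Definition grid_left (e : edge grid) :=
  if e.2 then face e.1.1 e.1.2.+1 else face e.1.1.+1 e.1.2.
Definition grid_right (e : edge grid) := face e.1.1.+1 e.1.2.+1.

(** Vertices with a coordinate equal to [n] have no outgoing edges; extending chains by zero there
    makes one boundary formula valid at all vertices. *)
Let ext (z : edge grid -> 'F_2) (h : bool) (i j : nat) : 'F_2 :=
  if (i < n)%N && (j < n)%N then z (inord i, inord j, h) else 0.

Let extE (z : edge grid -> 'F_2) (e : edge grid) : z e = ext z e.2 e.1.1 e.1.2.
Proof. by case: e => [[i j] h]; rewrite /ext !ltn_ord /= !inord_val. Qed.

Let bdry_grid z (v : vert grid) : bdry z v =
  (ext z false v.1 v.2 + (if (0 < v.1)%N then ext z false v.1.-1 v.2 else 0)) +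
  (ext z true v.1 v.2 + (if (0 < v.2)%N then ext z true v.1 v.2.-1 else 0)).
Proof.
have sum_at h i j : ext z h i j = \sum_(e : edge grid) z e *
    [&& e.2 == h, e.1.1 == i :> nat & e.1.2 == j :> nat]%:R.
  rewrite /ext; case: ifP => [/andP[ltin ltjn]|nlt].
    rewrite (bigD1 (inord i, inord j, h)) //= !inordK // !eqxx mulr1.
    rewrite big1 ?addr0 // => -[[i' j'] h'] ne.
    case: and3P => [[/eqP/= eh /eqP/= ei /eqP/= ej]|]; last by rewrite mulr0.
    by case/eqP: ne; rewrite -eh -ei -ej !inord_val.
  rewrite big1 // => -[[i' j'] h'] _ /=.
  case: and3P => [[_ /eqP ei /eqP ej]|]; last by rewrite mulr0.
  by rewrite -ei -ej !ltn_ord in nlt.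
have sum_src : \sum_(e : edge grid) z e * (src e == v)%:R =
    ext z false v.1 v.2 + ext z true v.1 v.2.
  rewrite !sum_at -big_split; apply: eq_bigr => -[[i j] h] _ /=.
  rewrite -mulrDr; congr (_ * _); case: (v) => v1 v2 /=.
  have := ltn_ord i; have := ltn_ord j; move=> lj li.
  rewrite xpair_eqE -!val_eqE /= !inordK; try lia.
  by case: h; rewrite /= ?addr0 ?add0r.
have sum_tgt : \sum_(e : edge grid) z e * (tgt e == v)%:R =
    (if (0 < v.1)%N then ext z false v.1.-1 v.2 else 0) +
    (if (0 < v.2)%N then ext z true v.1 v.2.-1 else 0).
  have -> : (if (0 < v.1)%N then ext z false v.1.-1 v.2 else 0) =
     \sum_(e : edge grid) z e * [&& e.2 == false, e.1.1.+1 == v.1 & e.1.2 == v.2 :> nat]%:R.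
    case: (nat_of_ord v.1) => [|k] /=; last by rewrite sum_at.
    by rewrite big1 // => e _; rewrite andbF mulr0.
  have -> : (if (0 < v.2)%N then ext z true v.1 v.2.-1 else 0) =
     \sum_(e : edge grid) z e * [&& e.2 == true, e.1.1 == v.1 :> nat & e.1.2.+1 == v.2]%:R.
    case: (nat_of_ord v.2) => [|k] /=; last by rewrite sum_at.
    by rewrite big1 // => e _; rewrite !andbF mulr0.
  rewrite -big_split. apply: eq_bigr; case=> [[p q] h] _ /=.
  rewrite -mulrDr; congr (_ * _); case: (v) => v1 v2 /=.
  have := ltn_ord p; have := ltn_ord q; move=> lj li.
  rewrite xpair_eqE -!val_eqE /= !inordK; try by case: (h) => /=; lia.
  by case: h; rewrite /= ?addn0 ?addn1 ?addr0 ?add0r.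
rewrite /bdry; under eq_bigr do rewrite mulrDr.
by rewrite big_split /= sum_src sum_tgt addrACA.
Qed.

Lemma grid_has_dual : has_dual grid.
Proof.
exists ('I_n * 'I_n)%type, grid_left, grid_right => z; split=> [cz|[a az] v]; last first.
  pose A i j := a (face i j).
  have A0j j : A 0%N j = A 0%N 0%N by [].
  have Ai0 i : A i 0%N = A 0%N 0%N by rewrite /A /face !andbF.
  have Anj i j : (n <= i)%N -> A i j = A 0%N 0%N.
    by move=> ni; rewrite /A /face [(i < n)%N]ltnNge ni /= andbF.
  have Ain i j : (n <= j)%N -> A i j = A 0%N 0%N.
    by move=> nj; rewrite /A /face [(j < n)%N]ltnNge nj /= !andbF.
  have zh i j : ext z false i j = A i.+1 j + A i.+1 j.+1.
    rewrite /ext; case: ifP => [/andP[ltin ltjn]|/negbT].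
      by rewrite az /grid_left /grid_right /= !inordK.
    by rewrite negb_and -!leqNgt => /orP[h|h]; [rewrite !(Anj i.+1) | rewrite !(Ain i.+1)];
      rewrite ?addF2 //; lia.
  have zv i j : ext z true i j = A i j.+1 + A i.+1 j.+1.
    rewrite /ext; case: ifP => [/andP[ltin ltjn]|/negbT].
      by rewrite az /grid_left /grid_right /= !inordK.
    by rewrite negb_and -!leqNgt => /orP[h|h]; [rewrite (Anj i) ?(Anj i.+1) | rewrite !Ain];
      rewrite ?addF2 //; lia.
  rewrite bdry_grid.
  have -> : (if (0 < v.1)%N then ext z false v.1.-1 v.2 else 0) = A v.1 v.2 + A v.1 v.2.+1.
    by case: (nat_of_ord v.1) => [|k] /=; rewrite ?zh // !A0j addF2.
  have -> : (if (0 < v.2)%N then ext z true v.1 v.2.-1 else 0) = A v.1 v.2 + A v.1.+1 v.2.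
    by case: (nat_of_ord v.2) => [|k] /=; rewrite ?zv // !Ai0 addF2.
  (* Each of the four squares around a vertex borders two of its four edges, hence cancels. *)
  rewrite zh zv.
  set p := A _ _; set q := A _ _; set r := A _ _; set s := A _ _.
  have -> : (p + q) + (r + s) + ((s + q) + (r + p)) = (p + p) + (q + q) + (r + r) + (s + s) by ring.
  by rewrite !addF2.
(* The parity of the edges of [z] met by the vertical ray going down from [face i j]. *)
pose A i j : 'F_2 := if i is i'.+1 then \sum_(0 <= k < j) ext z false i' k else 0.
have vertex i j : (i < n.+1)%N -> (j < n.+1)%N ->
   (ext z false i j + (if (0 < i)%N then ext z false i.-1 j else 0)) +
   (ext z true i j + (if (0 < j)%N then ext z true i j.-1 else 0)) = 0.
  by move=> li lj; have := cz (inord i, inord j); rewrite bdry_grid /= !inordK.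
have hE i j : ext z false i j = A i.+1 j + A i.+1 j.+1.
  by rewrite /A big_nat_recr //= addrA addF2 add0r.
have out h i j : (n <= i)%N || (n <= j)%N -> ext z h i j = 0.
  by rewrite /ext => nij; case: ifP => //; lia.
(* Induction up the column: the cycle condition at a vertex passes the identity from the vertical
   edge below it to the one above. *)
have vE i j : (i < n.+1)%N -> (j < n)%N -> ext z true i j = A i j.+1 + A i.+1 j.+1.
  move=> li; elim: j => [|j IHj] lj.
    have /F2_cancel := vertex i 0%N li (ltnW lj); rewrite /= addr0 => <-.
    by rewrite addrC; case: i {li} => [|i] /=; rewrite !big_nat1.
  have := IHj (ltnW lj); have /F2_cancel := vertex i j.+1 li (ltnW lj).
  rewrite [j.+1.-1]/= [(0 < j.+1)%N]/= => e1 e2; rewrite e2 in e1; move: e1.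
  have -> : A i j.+2 = A i j.+1 + (if (0 < i)%N then ext z false i.-1 j.+1 else 0).
    by case: (i) => [|i'] /=; rewrite ?addr0 // big_nat_recr.
  have -> : A i.+1 j.+2 = A i.+1 j.+1 + ext z false i j.+1.
    by rewrite /= big_nat_recr.
  move=> e; rewrite addrACA [X in _ + X]addrC e addrCA.
  by rewrite addF2 addr0.
(* A vertex of the last column or top row meets at most one edge, which no cycle uses. So [A]
   vanishes on all outer squares and factors through [face]. *)
have Anj j : (j <= n)%N -> A n j = 0.
  move=> jn; change (\sum_(0 <= k < j) ext z false m k = 0).
  rewrite big_nat big1 // => k /andP[_ kj].
  have := vertex n k (ltnSn _) (leq_trans kj (leqW jn)).
  rewrite !(out _ n) ?leqnn // add0r => /F2_cancel e; apply: etrans e _.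
  by rewrite add0r; case: ifP.
have Ain i : (i <= n)%N -> A i n = 0.
  elim: i => [//|i IHi] lin; have := vE i m (leqW lin) (ltnSn _).
  rewrite IHi ?(ltnW lin) // add0r => <-.
  have := vertex i n (leqW lin) (ltnSn _).
  by rewrite !(out _ _ n) ?leqnn ?orbT //= add0r; case: ifP => _; rewrite ?add0r.
exists (fun f : 'I_n * 'I_n => A f.1 f.2).
have AE i j : (i <= n)%N -> (j <= n)%N -> A (face i j).1 (face i j).2 = A i j.
  move=> li lj; rewrite /face; case: ifP => [/and4P[_ ltin _ ltjn]|out']; first by rewrite !inordK.
  have : [|| i == 0, j == 0, i == n | j == n]%N by lia.
  case/or4P => /eqP->; rewrite ?Anj ?Ain //.
  by case: (i) => //= i'; rewrite big_geq.
move=> [[i j] h]; rewrite /grid_left /grid_right extE /=.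
have := ltn_ord i; have := ltn_ord j; move=> lj li.
case: h; rewrite /= !AE ?(ltnW li) ?(ltnW lj) //.
  by rewrite vE // ltnW.
Qed.

End Grid.

(** * Blocks of four grid vertices *)

Section Blocks.
Variable m : nat.

(** The block stands for the mesh cell [p]: cells that share a side or a corner have overlapping
    blocks, and all other pairs of distinct cells have disjoint ones. *)
Definition block (p : nat * nat) : {set vert (grid m)} :=
  [set w : vert (grid m) | (p.1 <= w.1 <= p.1.+1) && (p.2 <= w.2 <= p.2.+1)].

(** The bounds keep all coordinates at most [m], away from the last row and column, where grid edges
    are missing. *)
Lemma block_connected p : p.1 < m -> p.2 < m -> connected_set (block p).
Proof.
case: p => a b /= am bm; set A := block _.
pose V i j : vert (grid m) := (inord i, inord j).
have inA i j : i <= 1 -> j <= 1 -> V (a + i) (b + j) \in A.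
  by move=> i1 j1; rewrite inE /= !inordK; lia.
have step i j (h : bool) : i + ~~ h <= 1 -> j + h <= 1 ->
    link A (V (a + i) (b + j)) (V (a + (i + ~~ h)) (b + (j + h))).
  move=> ih jh; rewrite /link !inA //; try lia.
  apply/existsP; exists (inord (a + i), inord (b + j), h); rewrite /= !inordK; try lia.
  by rewrite /V !addnA !eqxx.
have to_corner u : u \in A -> connect (link A) u (V a b).
  case: u => u1 u2; rewrite inE /= => u12.
  have -> : (u1, u2) = V (a + (u1 - a)) (b + (u2 - b)).
    by congr pair; apply/val_inj; rewrite /= inordK; lia.
  rewrite [connect _ _ _](link_connect_sym (M := grid m)) -[a in V a b]addn0 -[b in V _ b]addn0.
  apply: (@connect_trans _ _ (V (a + (u1 - a)) (b + 0))).
    have [->|->] : u1 - a = 0 \/ u1 - a = 1 by lia.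
      exact: connect0.
    exact/connect1/(step 0 0 false).
  have [->|->] : u2 - b = 0 \/ u2 - b = 1 by lia.
    exact: connect0.
  have := step (u1 - a) 0 true; rewrite /= [u1 - a + 0]addn0 => st.
  by apply/connect1/st => //; lia.
by move=> u w /to_corner uv /to_corner; rewrite link_connect_sym; apply: connect_trans.
Qed.

Lemma block_meet p q : p.1 < m -> p.2 < m ->
  p.1 <= q.1.+1 -> q.1 <= p.1.+1 -> p.2 <= q.2.+1 -> q.2 <= p.2.+1 ->
  q.1 < m -> q.2 < m ->
  exists2 v, v \in block p & v \in block q.
Proof.
move=> p1 p2 pq1 qp1 pq2 qp2 q1 q2.
exists ((inord (maxn p.1 q.1), inord (maxn p.2 q.2)) : vert (grid m)).
  by rewrite inE /= !inordK; lia.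
by rewrite inE /= !inordK; lia.
Qed.

Lemma meet_block p q v : v \in block p -> v \in block q ->
  [/\ p.1 <= q.1.+1, q.1 <= p.1.+1, p.2 <= q.2.+1 & q.2 <= p.2.+1].
Proof. by rewrite !inE => vp vq; split; lia. Qed.

End Blocks.

(** * Arcs in the plane and grid minors *)

Section Compactness.
Import classical_sets.
Import Order.TTheory Num.Theory numFieldNormedType.Exports.
Variable R : realType.
Local Open Scope ring_scope.
Implicit Types (P : R -> R -> Prop) (g h : R -> R * R).

Lemma ball_prodE (p q : R * R) e :
  ball p e q = (`|p.1 - q.1| < e /\ `|p.2 - q.2| < e).
Proof. by rewrite -[RHS]/(ball_ Num.norm p.1 e q.1 /\ ball_ Num.norm p.2 e q.2) ball_normE. Qed.

(** A Lebesgue number argument: compactness of the segment, stated as a covering property for the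
    filter of [d] tending to [0] from the right, merges the local radii into one. *)
Lemma segment_uniform P :
  (forall d d' s, 0 < d' -> d' <= d -> P d s -> P d' s) ->
  (forall x : R, 0 <= x <= 1 -> exists2 d : R, 0 < d &
     forall s : R, 0 <= s <= 1 -> `|x - s| < d -> P d s) ->
  exists2 d : R, 0 < d & forall s : R, 0 <= s <= 1 -> P d s.
Proof.
move=> mono loc.
have /compact_near_coveringP/near_covering_withinP cov := @segment_compact R 0 1.
have := cov R (0^'+)%classic P _.
case.
  move=> x /=; rewrite in_itv /= => /loc[d d0 Pd].
  exists ([set s | `|x - s| < d], [set d' | 0 < d' <= d])%classic => /=.
    split; first by apply/nbhs_ballP; exists d => //= s; rewrite -ball_normE.
    exists d => //= d'; rewrite /ball_ /= sub0r normrN => d'd d'0.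
    by rewrite d'0 /= (le_trans (ler_norm _)) // ltW.
  move=> [s d'] /= [sd /andP[d'0 d'd]]; rewrite in_itv /= => s01.
  by apply: (mono d) => //; apply: Pd.
move=> e /= e0 Pe; exists (e / 2); first by rewrite divr_gt0.
move=> s s01; apply: (Pe (e / 2)); rewrite /= ?in_itv //=.
- by rewrite /ball_ /= sub0r normrN gtr0_norm; lra.
- by rewrite divr_gt0.
Qed.

Lemma fin_uniform (I : finType) (P : I -> R -> Prop) :
  (forall i d d', 0 < d' -> d' <= d -> P i d -> P i d') ->
  (forall i, exists2 d : R, 0 < d & P i d) ->
  exists2 d : R, 0 < d & forall i, P i d.
Proof.
move=> mono loc; have /choice[d0 Hd0] : forall i, exists d, 0 < d /\ P i d.
  by move=> i; have [d] := loc i; exists d.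
exists (\big[Num.min/1]_i d0 i).
  elim/big_ind: _ => // [x y x0 y0|i _]; last by case: (Hd0 i).
  by rewrite lt_min x0.
move=> i; apply: (mono i (d0 i)); [|exact: bigmin_le_cond|by case: (Hd0 i)].
elim/big_ind: _ => // [x y x0 y0|j _]; last by case: (Hd0 j).
by rewrite lt_min x0.
Qed.

Definition path_continuous g := forall x e : R, 0 <= x <= 1 -> 0 < e ->
  exists2 d : R, 0 < d & forall s : R, 0 <= s <= 1 -> `|x - s| < d -> ball (g x) e (g s).

Lemma within_path_continuous g :
  {within `[0, 1], continuous g}%classic -> path_continuous g.
Proof.
move=> /subspace_continuousP cg x e x01 e0.
have := cg x; rewrite /= in_itv /= => /(_ x01) /cvg_ballP/(_ e e0).
rewrite near_withinE => /nbhs_ballP[d d0 Hd]; exists d => // s s01 xs.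
by apply: Hd; rewrite -?ball_normE //= in_itv.
Qed.

Lemma path_uniform_continuous g e : path_continuous g -> 0 < e ->
  exists2 d : R, 0 < d & forall s t : R, 0 <= s <= 1 -> 0 <= t <= 1 -> `|s - t| < d ->
    ball (g s) e (g t).
Proof.
move=> cg e0.
have [||d d0 Hd] := @segment_uniform (fun d s => forall t : R, 0 <= t <= 1 ->
    `|s - t| < d -> ball (g s) e (g t)).
- by move=> d d' s d'0 d'd H t t01 st; apply: H => //; apply: lt_le_trans d'd.
- move=> x x01; have [d d0 Hd] := cg x (e / 2) x01 (divr_gt0 e0 (ltr0Sn _ 1)).
  exists (d / 2); first by rewrite divr_gt0.
  move=> s s01 xs t t01 st.
  apply: (@ball_splitr _ _ (g x)); apply: Hd => //; first by lra.
  by have := ler_distD s x t; lra.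
- by exists d => // s t s01 t01; apply: Hd.
Qed.

(** Compactness is used twice: first in [t], for a fixed point off the path [h], then in [s]. *)
Lemma disjoint_paths_distant g h : path_continuous g -> path_continuous h ->
  (forall s t : R, 0 <= s <= 1 -> 0 <= t <= 1 -> g s <> h t) ->
  exists2 d : R, 0 < d & forall s t : R, 0 <= s <= 1 -> 0 <= t <= 1 -> ~ ball (g s) d (h t).
Proof.
move=> cg ch gh.
have pt q : (forall t : R, 0 <= t <= 1 -> q <> h t) ->
    exists2 d : R, 0 < d & forall t : R, 0 <= t <= 1 -> ~ ball q d (h t).
  move=> qh; apply: segment_uniform => [d d' t _ d'd H /(le_ball d'd)//|x x01].
  have [e e0 He] : exists2 e, 0 < e & ~ ball q e (h x).
    have : (q.1 != (h x).1) || (q.2 != (h x).2).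
      rewrite -negb_and; apply: contra_notN (qh x x01).
      by move: {qh} q (h x) => [? ?] [? ?] /= /andP[/eqP-> /eqP->].
    case/orP => ne; [exists `|q.1 - (h x).1| | exists `|q.2 - (h x).2|];
      by rewrite ?normr_gt0 ?subr_eq0 // ball_prodE ltxx // => -[].
  have [d d0 Hd] := ch x (e / 2) x01 (divr_gt0 e0 (ltr0Sn _ 1)).
  have min_e : Num.min d (e / 2) <= e / 2 by rewrite ge_min lexx orbT.
  exists (Num.min d (e / 2)); first by rewrite lt_min d0 divr_gt0.
  move=> s s01; rewrite lt_min => /andP[xs _]; have {}Hd := Hd s s01 xs.
  move=> /(le_ball min_e) qs; apply: He.
  by apply: (@ball_splitl _ _ (h s)) => //; apply: ball_sym.
have [||d d0 Hd] := @segment_uniform (fun d s => forall t : R, 0 <= t <= 1 -> ~ ball (g s) d (h t)).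
- by move=> d d' s _ d'd H t t01 /(le_ball d'd); apply: H.
- move=> x x01; have [e e0 He] := pt (g x) (fun t => gh x t x01).
  have [d d0 Hd] := cg x (e / 2) x01 (divr_gt0 e0 (ltr0Sn _ 1)).
  have min_e : Num.min d (e / 2) <= e / 2 by rewrite ge_min lexx orbT.
  exists (Num.min d (e / 2)); first by rewrite lt_min d0 divr_gt0.
  move=> s s01; rewrite lt_min => /andP[xs _] t t01 /(le_ball min_e) st.
  by apply: (He t t01); apply: ball_split st; apply: Hd.
by exists d => // s t s01 t01; apply: Hd.
Qed.
End Compactness.

(** * Discretizing paths on a mesh *)

Section Discretization.
Import Order.TTheory Num.Theory numFieldNormedType.Exports.
Variable R : realType.
Local Open Scope ring_scope.

Lemma truncn_close (x y : R) : 0 <= x -> 0 <= y -> `|x - y| < 1 ->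
  (Num.truncn x <= (Num.truncn y).+1)%N.
Proof.
move=> /truncn_itv/andP[x1 _] /truncn_itv/andP[_ y2].
rewrite ltr_norml => /andP[_ xy]; rewrite -ltnS -(ltr_nat R).
by rewrite -!natr1 in y2 *; lra.
Qed.

Lemma truncn_near (x y : R) : 0 <= x -> 0 <= y ->
  (Num.truncn x <= (Num.truncn y).+1)%N -> (Num.truncn y <= (Num.truncn x).+1)%N ->
  `|x - y| < 2.
Proof.
move=> /truncn_itv/andP[x1 x2] /truncn_itv/andP[y1 y2].
rewrite -(ler_nat R) => xy; rewrite -(ler_nat R) => yx.
by rewrite ltr_norml; move: x2 y2 xy yx; rewrite -!natr1 => *; apply/andP; split; lra.
Qed.

(** [D i] is the union of the blocks of the cells containing sample points of [g i]. Consecutive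
    samples lie in equal or neighbouring cells, endpoints are among the samples, and disjoint paths
    are far apart compared with the mesh. *)
Lemma discretize (I : finType) (g : I -> R -> R * R) :
  (forall i, path_continuous (g i)) ->
  exists m (D : I -> {set vert (grid m)}),
    [/\ forall i, connected_set (D i),
        forall i j (a b : bool), g i a%:R = g j b%:R -> exists2 v, v \in D i & v \in D j &
        forall i j, (forall s t : R, 0 <= s <= 1 -> 0 <= t <= 1 -> g i s <> g j t) ->
          forall v, v \in D i -> v \in D j -> False].
Proof.
move=> cg.
pose apart i j := forall s t : R, 0 <= s <= 1 -> 0 <= t <= 1 -> g i s <> g j t.
have [|[i j]|d d0 Hd] := @fin_uniform R (I * I)%type (fun ij d => apart ij.1 ij.2 ->
  forall s t : R, 0 <= s <= 1 -> 0 <= t <= 1 -> ~ ball (g ij.1 s) d (g ij.2 t)).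
- move=> [i j] d d' _ d'd H ij s t s01 t01 /(le_ball d'd).
  exact: H ij s t s01 t01.
- have [ij|nij] := pselect (apart i j); last by exists 1.
  by have [d d0 Hd] := disjoint_paths_distant (cg i) (cg j) ij; exists d.
(* The mesh width: points in cells with overlapping blocks differ by less than [2 h = d] in each
   coordinate. *)
pose h := d / 2; have h0 : 0 < h by rewrite divr_gt0.
have [e e0 He] := @fin_uniform R I (fun i e => forall s t : R, 0 <= s <= 1 -> 0 <= t <= 1 ->
    `|s - t| < e -> ball (g i s) h (g i t))
  (fun i d d' _ d'd H s t s01 t01 st => H s t s01 t01 (lt_le_trans st d'd))
  (fun i => path_uniform_continuous (cg i) h0).
(* With [N.+1] equal steps each step is shorter than [e], so consecutive samples are less than [h]
   apart. *)
pose N := Num.truncn e^-1; pose tau k : R := k%:R / N.+1%:R.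
have N0 : 0 < N.+1%:R :> R by rewrite ltr0Sn.
have tau01 k : (k <= N.+1)%N -> 0 <= tau k <= 1.
  by move=> kN; rewrite /tau divr_ge0 ?ler0n //= ler_pdivrMr // mul1r ler_nat.
have tau_step k : `|tau k - tau k.+1| < e.
  rewrite /tau -mulrBl -addn1 natrD opprD addrA subrr sub0r mulN1r normrN gtr0_norm ?invr_gt0 //.
  rewrite invf_plt ?posrE //.
  by have /truncn_itv/andP[_] : 0 <= e^-1 by rewrite invr_ge0 ltW.
(* A crude bound on all sampled coordinates; [co] adds it so that truncation is applied to
   nonnegative numbers. *)
pose L := \sum_(ik : I * 'I_N.+2) (`|(g ik.1 (tau ik.2)).1| + `|(g ik.1 (tau ik.2)).2|).
have bound i k : (k <= N.+1)%N -> `|(g i (tau k)).1| <= L /\ `|(g i (tau k)).2| <= L.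
  move=> kN; have Lk : `|(g i (tau k)).1| + `|(g i (tau k)).2| <= L.
    rewrite /L (bigD1 (i, Ordinal (kN : (k < N.+2)%N))) //= lerDl.
    by apply: sumr_ge0 => ik _; rewrite addr_ge0.
  have := normr_ge0 (g i (tau k)).1; have := normr_ge0 (g i (tau k)).2.
  by move: Lk; split; lra.
pose co (x : R) := Num.truncn ((x + L) / h).
pose cell i k := (co (g i (tau k)).1, co (g i (tau k)).2).
pose m := (co L).+1.
have co_ge0 (x : R) : `|x| <= L -> 0 <= (x + L) / h.
  by rewrite ler_norml => /andP[xL _]; rewrite divr_ge0 ?(ltW h0) //; lra.
have co_le (x : R) : `|x| <= L -> (co x < m)%N.
  move=> xL; rewrite ltnS; apply: le_truncn; rewrite ler_pM2r ?invr_gt0 //.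
  by rewrite lerD2r (le_trans (ler_norm x)).
have co_close (x y : R) : `|x| <= L -> `|y| <= L -> `|x - y| < h -> (co x <= (co y).+1)%N.
  move=> xL yL xy; apply: truncn_close; rewrite ?co_ge0 //.
  by rewrite -mulrBl opprD addrACA subrr addr0 normrM [`|h^-1|]gtr0_norm ?invr_gt0 //
    ltr_pdivrMr ?mul1r.
have co_near (x y : R) : `|x| <= L -> `|y| <= L ->
    (co x <= (co y).+1)%N -> (co y <= (co x).+1)%N -> `|x - y| < d.
  move=> xL yL xy yx; have := truncn_near (co_ge0 x xL) (co_ge0 y yL) xy yx.
  rewrite -mulrBl opprD addrACA subrr addr0 normrM [`|h^-1|]gtr0_norm ?invr_gt0 // ltr_pdivrMr //.
  by rewrite /h; lra.
exists m, (fun i => \bigcup_(k < N.+2) block m (cell i k)); split.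
- move=> i; apply: (@connected_chain _ _ (fun k => block m (cell i k))) => k kN.
    by have [b1 b2] := bound i k kN; apply: block_connected; apply: co_le.
  have [b1 b2] := bound i k (ltnW kN); have [b1' b2'] := bound i k.+1 kN.
  have : ball (g i (tau k)) h (g i (tau k.+1)).
    by apply: He (tau_step k); apply: tau01; rewrite // ltnW.
  rewrite ball_prodE => -[s1 s2].
  by apply: block_meet; rewrite ?co_le ?co_close //= 1?distrC.
- move=> i j a b gij.
  have tau_end (c : bool) : exists k : 'I_N.+2, tau k = c%:R.
    case: c; [exists ord_max | exists ord0]; rewrite /tau /= ?mul0r //.
    by rewrite divff // gt_eqF.
  have [k tk] := tau_end a; have [l tl] := tau_end b.
  have [bk1 bk2] := bound i k (ltn_ord k).
  have ck : cell i k = cell j l by rewrite /cell tk tl gij.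
  have [v vk _] := @block_meet m (cell i k) (cell i k) (co_le _ bk1) (co_le _ bk2)
    (leqnSn _) (leqnSn _) (leqnSn _) (leqnSn _) (co_le _ bk1) (co_le _ bk2).
  exists v; apply/finset.bigcupP; [exists k | exists l] => //.
  by rewrite -ck.
- move=> i j gij v /finset.bigcupP[k _ vk] /finset.bigcupP[l _ vl].
  have [c1 c2 c3 c4] := meet_block vk vl.
  have [bk1 bk2] := bound i k (ltn_ord k); have [bl1 bl2] := bound j l (ltn_ord l).
  apply: (Hd (i, j) gij (tau k) (tau l)); [exact: tau01 (ltn_ord k) | exact: tau01 (ltn_ord l) |].
  by rewrite ball_prodE; split; apply: co_near.
Qed.

End Discretization.

(** * From a plane drawing to a grid minor *)

Section DrawingMinor.
Import Order.TTheory Num.Theory numFieldNormedType.Exports.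
Variables (R : realType) (G : sgraph) (p : G -> R * R) (c : {set G} -> R -> R * R).
Hypothesis drawing : plane_drawing p c.
Local Open Scope ring_scope.

Let E := {e : {set G} | e \in edges G}.

Let arc_ends : exists st : E -> G * G, forall e,
  [/\ val e = [set (st e).1; (st e).2], c (val e) 0 = p (st e).1 & c (val e) 1 = p (st e).2].
Proof.
have [_ arcs _ _] := drawing.
suff /choice[st Hst] : forall e : E, exists xy : G * G,
    [/\ val e = [set xy.1; xy.2], c (val e) 0 = p xy.1 & c (val e) 1 = p xy.2] by exists st.
by move=> e; have [_ _ [x [y xyP]]] := arcs _ (valP e); exists (x, y).
Qed.

Let third (k : nat) (t : R) : R := (k%:R + t) / 3.

(** Arcs with a common end are not disjoint, so each is cut into thirds: the outer thirds will join
    the stars of the ends, and the middle thirds of different edges are disjoint. Vertices enter as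
    constant paths. *)
Let piece (i : G + E * 'I_3) : R -> R * R :=
  match i with
  | inl x => fun=> p x
  | inr ek => fun t => c (val ek.1) (third ek.2 t)
  end.

Let third01 (k : 'I_3) t : 0 <= t <= 1 -> 0 <= third k t <= 1.
Proof.
move=> t01; have k0 : 0 <= (k%:R : R) by rewrite ler0n.
have k2 : k%:R <= (2 : R) by rewrite ler_nat -ltnS.
by rewrite /third; lra.
Qed.

Let piece_continuous i : path_continuous (piece i).
Proof.
case: i => [x|[e k]] x0 eps x01 eps0 /=.
  by exists 1 => // s _ _; apply: ballxx.
have [_ arcs _ _] := drawing; have [ce _ _] := arcs _ (valP e).
have [d d0 Hd] := within_path_continuous ce (third01 k x01) eps0.
exists d => // s s01 xs; apply: Hd; first exact: third01.
rewrite /third -mulrBl opprD addrACA subrr add0r normrM [X in _ * X]gtr0_norm ?invr_gt0 //.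
by have := normr_ge0 (x0 - s); lra.
Qed.

Lemma drawing_grid_minor : exists m (U : G -> {set vert (grid m)}),
  [/\ forall x, exists v, v \in U x,
      forall x, connected_set (U x),
      forall x y v, v \in U x -> v \in U y -> x = y &
      forall x y, adj x y -> exists g : edge (grid m),
        (src g \in U x) && (tgt g \in U y) || (src g \in U y) && (tgt g \in U x)].
Proof.
have [p_inj arcs vertex_free arc_free] := drawing.
have [st stP] := arc_ends; pose s e := (st e).1; pose t e := (st e).2.
have [m [D [Dconn Dmeet Ddisj]]] := discretize piece_continuous.
have meet i j v : v \in D i -> v \in D j ->
    exists a b : R, [/\ 0 <= a <= 1, 0 <= b <= 1 & piece i a = piece j b].
  move=> vi vj; apply: contrapT => none; apply: (Ddisj i j _ v vi vj) => a b a01 b01 ab.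
  by apply: none; exists a, b.
(* [near x q]: the point [q] lies on the star of the arc thirds incident with [x]. *)
pose near x q := q = p x \/ exists (e : E) (a : R),
  [/\ 0 < a < 1, q = c (val e) a & s e = x /\ a <= 3^-1 \/ t e = x /\ 2 / 3 <= a].
pose mid (e : E) q := exists a : R, [/\ 3^-1 <= a, a <= 2 / 3 & q = c (val e) a].
have on_vertex (e : E) (a : R) x : c (val e) a = p x -> 0 < a < 1 -> False.
  by move=> /[swap] a01; apply: vertex_free => //; exact: valP.
have same_arc (e f : E) (a b : R) :
    c (val e) a = c (val f) b -> 0 < a < 1 -> 0 < b < 1 -> e = f /\ a = b.
  move=> eab a01 b01; have ef : e = f.
    apply/val_inj; apply: contrapT => /eqP nef; move: eab.
    by apply: arc_free => //; exact: valP.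
  split=> //; have [_ inj _] := arcs _ (valP e); apply: inj; rewrite ?eab ?ef ?in_itv //=.
    by move: a01; lra.
  by move: b01; lra.
have near_inj x y q : near x q -> near y q -> x = y.
  case=> [->|[e [a [a01 -> ea]]]].
    case=> [/p_inj//|[f [b [b01 /esym/on_vertex/(_ b01)[]]]]].
  case=> [/on_vertex/(_ a01)[]|[f [b [b01 /same_arc/(_ a01 b01)[ef ab] fb]]]].
  by subst f b; case: ea fb => -[<- ha] [] [<- hb] //; exfalso; lra.
have mid_inj e f q : mid e q -> mid f q -> e = f.
  case=> a [a1 a2 ->] [b [b1 b2 /same_arc[]]] //; lra.
have near_mid x e q : near x q -> mid e q -> x = s e \/ x = t e.
  case=> [->|[f [b [b01 -> fb]]]] [a [a1 a2]].
    move=> /esym/on_vertex; case=> //; lra.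
  move=> /same_arc/(_ b01) fe; have {}fe : f = e by case: fe => //; lra.
  by subst f; case: fb => -[-> _]; [left|right].
(* The discrete star of [x], made of its point and the arc thirds at it. The index [None] covers
   isolated vertices; repeating [D (inl x)] in each term makes every term connected. *)
pose K x := \bigcup_(j : option (E * bool) |
     if j is Some (e, b) then (if b then t e else s e) == x else true)
  (D (inl x) :|: if j is Some (e, b) then D (inr (e, if b then ord_max else ord0)) else set0).
pose M e := D (inr (e, inord 1)).
have K_near x v : v \in K x -> exists2 i, v \in D i & forall a, 0 <= a <= 1 -> near x (piece i a).
  case/bigcupP => j jx /setUP[vx|]; first by exists (inl x) => // a _; left.
  case: j jx => [[e b]|] /= ex; rewrite ?inE // => vj; eexists; first exact: vj.
  move=> a a01 /=; have [_ c0 c1] := stP e.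
  case: b ex vj => /eqP ex _ /=.
    (* The last parameter of the last third is the vertex itself, which [near] treats apart from
       interior points of arcs. *)
    have [->|a1] := eqVneq a 1.
      by left; rewrite /third (_ : _ / _ = 1) ?c1 -?ex //; lra.
    right; exists e, (third 2 a); split=> //; rewrite /third; first by lra.
    by right; split=> //; lra.
  have [->|a0] := eqVneq a 0.
    by left; rewrite /third (_ : _ / _ = 0) ?c0 -?ex //; lra.
  right; exists e, (third 0 a); split=> //; rewrite /third; first by lra.
  by left; split=> //; lra.
have M_mid e a : 0 <= a <= 1 -> mid e (piece (inr (e, inord 1)) a).
  by move=> a01; exists (third 1 a); rewrite /= inordK // /third; split=> //; lra.
have K_disj x y v : v \in K x -> v \in K y -> x = y.
  case/K_near => i vi ix /K_near[j vj jy]; have [a [b [a01 b01 ab]]] := meet _ _ _ vi vj.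
  by apply: near_inj (ix a a01) _; rewrite ab; apply: jy.
have M_disj e f v : v \in M e -> v \in M f -> e = f.
  move=> ve vf; have [a [b [a01 b01 ab]]] := meet _ _ _ ve vf.
  by apply: mid_inj (M_mid e a a01) _; rewrite ab; apply: M_mid.
have K_M x e v : v \in K x -> v \in M e -> x = s e \/ x = t e.
  case/K_near => i vi ix ve; have [a [b [a01 b01 ab]]] := meet _ _ _ vi ve.
  by apply: near_mid (ix a a01) _; rewrite ab; apply: M_mid.
have D_nonempty i : exists v, v \in D i.
  by have [v vi _] := Dmeet i i false false erefl; exists v.
have K_conn x : connected_set (K x).
  have [v vx] := D_nonempty (inl x).
  apply: (@connected_bigcup _ _ _ _ v) => -[[e b]|] //= ex; last first.
    by rewrite setU0; split; [exact: Dconn | ].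
  split; last by rewrite inE vx.
  have [_ c0 c1] := stP e.
  have [w wx we] : exists2 w, w \in D (inl x) & w \in D (inr (e, if b then ord_max else ord0)).
    apply: (Dmeet _ _ false b) => /=.
    by case: b ex => /eqP ex; rewrite /third /= ?add0r ?mul0r ?c0 -?ex //
      (_ : _ / _ = 1) ?c1 //; lra.
  by apply: (@connected_setU _ _ _ w).
have K_base x v : v \in D (inl x) -> v \in K x.
  by move=> vx; apply/bigcupP; exists None => //; rewrite inE vx.
have K_end e b v : v \in D (inr (e, if b then ord_max else ord0)) ->
    v \in K (if b then t e else s e).
  by move=> vi; apply/bigcupP; exists (Some (e, b)) => //=; rewrite inE vi orbT.
have /choice[u uP] : forall e, exists u, u \in M e /\ u \in K (s e).
  move=> e; have [v ve vk] : exists2 v, v \in M e & v \in D (inr (e, ord0)).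
    apply: (Dmeet _ _ false true); rewrite /= inordK // /third; congr (c _ _); lra.
  by exists v; split=> //; apply: (K_end e false).
have /choice[w wP] : forall e, exists w, w \in M e /\ w \in K (t e).
  move=> e; have [v ve vk] : exists2 v, v \in M e & v \in D (inr (e, ord_max)).
    apply: (Dmeet _ _ true false); rewrite /= inordK // /third; congr (c _ _); lra.
  by exists v; split=> //; apply: (K_end e true).
have s_neq_t e : s e != t e.
  have := valP e; have [-> _ _] := stP e; rewrite inE => /existsP[x /existsP[y /andP[xy /eqP exy]]].
  apply/eqP => st_e; move: exy; rewrite -/(s e) -/(t e) st_e setUid => /setP exy.
  have := exy x; have := exy y; rewrite !inE !eqxx orbT => /eqP yt /eqP xt.
  by rewrite xt yt adj_irr in xy.
(* The branch set of [s e] absorbs the middle third of [e] up to the star of [t e]. *)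
pose A e := [set v | connect (link (M e :\: K (t e))) (u e) v].
have uMK e : u e \in M e :\: K (t e).
  have [uM uK] := uP e; rewrite inE uM andbT.
  by apply: contra (s_neq_t e) => /(K_disj _ _ _ uK) ->.
have A_sub e v : v \in A e -> v \in M e :\: K (t e).
  by rewrite inE; apply: connect_subset.
have uA e : u e \in A e by rewrite inE connect0.
pose U x := \bigcup_(j : option E | if j is Some e then s e == x else true)
  (K x :|: if j is Some e then A e else set0).
have U_K x v : v \in K x -> v \in U x.
  by move=> vx; apply/bigcupP; exists None => //; rewrite inE vx.
have U_A e v : v \in A e -> v \in U (s e).
  by move=> vx; apply/bigcupP; exists (Some e) => //; rewrite inE vx orbT.
have U_cases x v : v \in U x -> v \in K x \/ exists e, [/\ s e = x, v \in M e & v \notin K (t e)].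
  case/bigcupP => j jx /setUP[|]; first by left.
  case: j jx => [e /eqP ex /A_sub|]; rewrite inE // => /andP[vK vM].
  by right; exists e.
have U_adj e : exists g : edge (grid m), (src g \in U (s e)) && (tgt g \in U (t e)) ||
    (src g \in U (t e)) && (tgt g \in U (s e)).
  have [wM wK] := wP e; have wA : w e \notin A e.
    by apply/negP => /A_sub; rewrite inE wK.
  (* A walk inside [M e] from [u e] to [w e] leaves [A e] along some grid edge; its outer end lies
     in [K (t e)], as it would otherwise still be reachable. *)
  have [a [b [aA bA ab]]] := connect_crossing (P := mem (A e)) (Dconn _ _ _ (uP e).1 wM) (uA e) wA.
  have aMK := A_sub _ _ aA; case/and3P: (ab) => aM bM /existsP[g gab].
  have bK : b \in K (t e).
    apply: contraNT bA => bK; rewrite /= inE.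
    apply: (@connect_trans _ _ a); first by move: aA; rewrite /= inE.
    apply: connect1; rewrite /link aMK inE bK bM /=.
    by apply/existsP; exists g.
  have aU : a \in U (s e) by apply: U_A.
  have bU : b \in U (t e) by apply: U_K.
  by exists g; case/orP: gab => /andP[/eqP-> /eqP->]; rewrite aU bU ?orbT.
exists m, U; split=> [x|x|x y v|x y xy].
- by have [v /K_base/U_K vx] := D_nonempty (inl x); exists v.
- have [v /K_base vx] := D_nonempty (inl x).
  apply: (@connected_bigcup _ _ _ _ v) => -[e|] //= ex; last by rewrite setU0.
  split; last by rewrite inE vx.
  apply: (@connected_setU _ _ _ (u e)); [exact: K_conn | exact: reachable_connected | | exact: uA].
  by rewrite -(eqP ex); have [] := uP e.
- case/U_cases => [vx|[e [<- ve vte]]] /U_cases[vy|[f [<- vf vtf]]].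
  + exact: K_disj vx vy.
  + by case: (K_M _ _ _ vx vf) => // xt; rewrite xt in vx; rewrite vx in vtf.
  + by case: (K_M _ _ _ vy ve) => // xt; rewrite xt in vy; rewrite vy in vte.
  + by rewrite (M_disj _ _ _ ve vf).
have xyE : [set x; y] \in edges G.
  by rewrite inE; apply/existsP; exists x; apply/existsP; exists y; rewrite xy eqxx.
pose e : E := exist (fun e => e \in edges G) [set x; y] xyE; have [g ge] := U_adj e; exists g.
(* The arc may run from [x] to [y] or from [y] to [x]. *)
have [/= /setP exy _ _] := stP e.
have := exy x; have := exy y; have := exy (s e); have := exy (t e).
have xny : x != y by apply: contraTneq xy => ->; rewrite adj_irr.
rewrite !inE -/(s e) -/(t e) !eqxx ?orbT /= => /orP[]/eqP tE /orP[]/eqP sE.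
- by have := s_neq_t e; rewrite tE sE eqxx.
- by move: ge; rewrite tE sE orbC.
- by move: ge; rewrite tE sE.
- by have := s_neq_t e; rewrite tE sE eqxx.
Qed.

End DrawingMinor.

(** * The edge bound for planar bipartite graphs *)

Definition edge_count (G : sgraph) (A B : {set G}) : nat :=
  \sum_(x in A) \sum_(y in B) adj x y.

(** The grid minor is restricted to the edges between [A] and [B], each oriented from [A] to [B];
    its dual comes from the grid. *)
Lemma planar_bipartite_bound (R : realType) (G : sgraph) (A B : {set G}) :
  planar R G -> [disjoint A & B] -> 3 <= #|A| + #|B| ->
  edge_count A B + 4 <= 2 * (#|A| + #|B|).
Proof.
case=> p [c /drawing_grid_minor[m [U [Une Uconn Udisj Uadj]]]] AB AB3.
have notB x : x \in A -> x \notin B by move=> xA; rewrite (disjointFr AB).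
pose V := {x | x \in A :|: B}.
pose E := {xy : G * G | [&& xy.1 \in A, xy.2 \in B & adj xy.1 xy.2]}.
have srcP (e : E) : (val e).1 \in A :|: B by case/and3P: (valP e) => eA _ _; rewrite inE eA.
have tgtP (e : E) : (val e).2 \in A :|: B by case/and3P: (valP e) => _ eB _; rewrite inE eB orbT.
pose N := @Multigraph V E (fun e => exist (fun x => x \in A :|: B) _ (srcP e))
  (fun e => exist (fun x => x \in A :|: B) _ (tgtP e)).
have cardV : #|vert N| = #|A| + #|B|.
  by rewrite card_sig; apply/eqP; move: AB; rewrite -(leq_card_setU A B).2.
have cardE : #|edge N| = edge_count A B.
  rewrite /edge_count pair_big_dep /= card_sig -sum1_card [RHS]big_mkcond [LHS]big_mkcond /=.
  apply: eq_bigr => -[x y] _; rewrite inE /=.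
  by case: (x \in A); case: (y \in B); case: (adj x y).
have /choice[b bU] : forall x : vert N, exists v, v \in U (val x) by move=> x; apply: Une.
have /choice[rep repP] : forall e : edge N, exists g : edge (grid m),
    (src g \in U (val (src e))) && (tgt g \in U (val (tgt e))) ||
    (src g \in U (val (tgt e))) && (tgt g \in U (val (src e))).
  by move=> e; apply: Uadj; case/and3P: (valP e).
have loopless (e : edge N) : src e != tgt e.
  apply/negP => /eqP/(congr1 val) /= e12; case/and3P: (valP e) => /notB.
  by rewrite e12 => /negbTE->.
have ends_inj (e f : edge N) : src e = src f -> tgt e = tgt f -> e = f.
  move=> /(congr1 val) /= e1 /(congr1 val) /= e2; apply/val_inj.
  by rewrite [val e]surjective_pairing [val f]surjective_pairing e1 e2.
(* A grid edge determines the unordered pair of branch sets that it joins, and the orientation from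
   [A] to [B] fixes the order. *)
have rep_inj : injective rep.
  move=> e f ef; have := repP e; rewrite ef => re; have rf := repP f.
  have anti : val (src e) = val (tgt f) -> False.
    by case/and3P: (valP e) (valP f) => /notB eA _ _ /and3P[_ fB _] /= ef'; rewrite ef' fB in eA.
  case/orP: re => /andP[s1 t1]; case/orP: rf => /andP[s2 t2].
  - by apply: ends_inj; apply: val_inj; [apply: Udisj s1 s2 | apply: Udisj t1 t2].
  - by case: (anti (Udisj _ _ _ s1 s2)).
  - by case: (anti (Udisj _ _ _ t1 t2)).
  - by apply: ends_inj; apply: val_inj; [apply: Udisj t1 t2 | apply: Udisj s1 s2].
have dualN : has_dual N.
  apply: (@has_dual_minor (grid m) N (fun x => U (val x)) b rep) => //.
  - by move=> x y v vx vy; apply/val_inj; apply: Udisj vx vy.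
  - exact: grid_has_dual.
rewrite -cardE -cardV; apply: dual_edge_bound => //; last by rewrite cardV.
apply: (@bipartite_girth N [set x | val x \in A]) => // e.
by rewrite !inE; case/and3P: (valP e) => eA eB _ /=; rewrite eA (disjointFl AB eB).
Qed.

(** * {1,2}-factors *)

Lemma subset_of_card (T : finType) (A : {set T}) k :
  k <= #|A| -> exists2 B : {set T}, B \subset A & #|B| = k.
Proof.
move=> /card_geqP[s [us ss sA]]; exists [set x in s].
  by apply/subsetP => x; rewrite inE => /sA.
by rewrite cardsE (card_uniqP us).
Qed.

(** The Halmos-Vaughan induction on the domain [D], with varying neighbourhoods. A tight nonempty
    proper subset [X] is matched first, then the rest of [D] outside the neighbourhood of [X]; if
    there is none, an arbitrary pair is split off. *)
Lemma hall (T : finType) (N : T -> {set T}) :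
  (forall X : {set T}, #|X| <= #|\bigcup_(x in X) N x|) ->
  exists2 f : T -> T, injective f & forall x, f x \in N x.
Proof.
move=> hN; have matching (D : {set T}) (N' : T -> {set T}) :
    (forall X : {set T}, X \subset D -> #|X| <= #|\bigcup_(x in X) N' x|) ->
    exists2 f : T -> T, {in D &, injective f} & {in D, forall x, f x \in N' x}; last first.
  have [X _|f injf fN] := matching setT N; first exact: hN.
  by exists f => [x y|x]; [apply: injf | apply: fN]; rewrite inE.
have [n] := ubnP #|D|; elim: n D {N hN} N' => // n IHn D N.
rewrite ltnS => Dn hN.
have [->|[x0 x0D]] := set_0Vmem D; first by exists id => x; rewrite inE.
case: (pickP (fun X : {set T} => [&& X \proper D, X != set0 & #|\bigcup_(x in X) N x| <= #|X|])).
  move=> X /and3P[XD X0 NX]; set W := \bigcup_(x in X) N x in NX.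
  have [XsubD _] := properP XD; have Xn := proper_card XD.
  have [||f1 inj1 f1N] := IHn X N; first by apply: leq_trans Xn Dn.
    by move=> Y YX; apply: hN; apply: subset_trans XsubD.
  have [||f2 inj2 f2N] := IHn (D :\: X) (fun z => N z :\: W).
  - apply: leq_trans Dn; rewrite -(cardsID X D) (setIidPr XsubD).
    by rewrite -[X in X < _]add0n ltn_add2r card_gt0.
  - move=> Y; rewrite subsetD => /andP[YD YX].
    have := hN (X :|: Y); rewrite subUset XsubD YD bigcup_setU -/W => /(_ isT).
    have -> : #|X :|: Y| = #|X| + #|Y|.
      by apply/eqP; rewrite (leq_card_setU X Y).2 disjoint_sym.
    have -> : #|W :|: \bigcup_(x in Y) N x| = #|W| + #|\bigcup_(x in Y) (N x :\: W)|.
      rewrite -(cardsID W) setIUl setIid setDUl setDv set0U.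
      rewrite (setUidPl _) ?subsetIr //; congr (_ + #|pred_of_set _|).
      apply/setP => y; rewrite inE; apply/andP/bigcupP => [[yW /bigcupP[x xY yx]]|[x xY]].
        by exists x; rewrite // inE yW.
      by rewrite inE => /andP[yW yx]; split=> //; apply/bigcupP; exists x.
    by move: NX; lia.
  exists (fun x => if x \in X then f1 x else f2 x) => [x y xD yD|x xD].
    case: (boolP (x \in X)) => xX; case: (boolP (y \in X)) => yX.
    - exact: inj1.
    - move=> fxy; have := f2N y; rewrite inE yX => /(_ yD); rewrite -fxy inE.
      by case/andP=> /bigcupP[]; exists x => //; apply: f1N.
    - move=> fxy; have := f2N x; rewrite inE xX => /(_ xD); rewrite fxy inE.
      by case/andP=> /bigcupP[]; exists y => //; apply: f1N.
    - by apply: inj2; rewrite inE ?xX ?yX.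
  case: ifPn => xX; first exact: f1N.
  by have := f2N x; rewrite inE xX => /(_ xD); rewrite inE => /andP[].
(* Now every nonempty proper subset has a neighbour to spare, which absorbs the loss of [y0]. *)
move=> tight.
have [y0 y0N] : exists y, y \in N x0.
  apply/set0Pn; rewrite -card_gt0.
  by have := hN [set x0]; rewrite sub1set x0D cards1 big_set1 => /(_ isT).
have [||f inj fN] := IHn (D :\ x0) (fun z => N z :\ y0).
- by apply: leq_trans Dn; rewrite (cardsD1 x0 D) x0D.
- move=> Y YD; have [->|Y0] := eqVneq Y set0; first by rewrite cards0.
  have := tight Y; rewrite Y0 /= (sub_proper_trans YD) ?properD1 //= => /negbT; rewrite -ltnNge.
  move=> /leq_trans h; rewrite -ltnS; apply: h.
  rewrite (cardsD1 y0 (\bigcup_(x in Y) N x)) -[X in _ <= X]add1n leq_add ?leq_b1 //.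
  apply: subset_leq_card; apply/subsetP => y; rewrite !inE => /andP[yy0 /bigcupP[x xY yx]].
  by apply/bigcupP; exists x; rewrite // !inE yy0.
exists (fun x => if x == x0 then y0 else f x) => [x y xD yD|x xD].
  case: eqVneq => [->|xx0]; case: eqVneq => [->|yx0] //.
  - by move=> y0f; have := fN y; rewrite !inE yx0 yD -y0f eqxx => /(_ isT).
  - by move=> y0f; have := fN x; rewrite !inE xx0 xD y0f eqxx => /(_ isT).
  - by apply: inj; rewrite !inE ?xx0 ?yx0.
case: eqVneq => [->//|xx0]; have := fN x; rewrite !inE xx0 xD => /(_ isT).
by case/andP.
Qed.

(* The cycles of the permutation [f] are the components of the factor. *)
Lemma injective_12_factor (G : sgraph) (f : G -> G) :
  injective f -> (forall x, adj x (f x)) -> has_12_factor G.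
Proof.
move=> injf fadj; exists [set [set x; f x] | x : G].
  apply/subsetP => e /imsetP[x _ ->]; rewrite inE.
  by apply/existsP; exists x; apply/existsP; exists (f x); rewrite fadj eqxx.
set F := [set _ | _ in _].
have f_irr x : x != f x by apply: contraTneq (fadj x) => <-; rewrite adj_irr.
have adjE (x y : G) : spanning_adj F x y = (y == f x) || (x == f y).
  rewrite /spanning_adj; apply/andP/orP => [[xy /imsetP[z _ /setP exy]]|].
    have := exy x; have := exy y; have xny : x != y by apply: contraTneq xy => ->; rewrite adj_irr.
    rewrite !inE !eqxx ?orbT /= => /esym/orP[/eqP yE|/eqP yE] /esym/orP[/eqP xE|/eqP xE].
    - by rewrite xE yE eqxx in xny.
    - by right; rewrite xE yE.
    - by left; rewrite xE yE.
    - by rewrite xE yE eqxx in xny.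
  case=> /eqP ->; first by rewrite fadj; split=> //; apply/imsetP; exists x.
  by rewrite adj_sym fadj setUC; split=> //; apply/imsetP; exists y.
(* The common degree in the component of [x]: one on the 2-cycles of [f], where successor and
   predecessor coincide, and two on longer cycles. *)
pose d (x : G) := (f (f x) != x).+1.
have d_adj (x y : G) : spanning_adj F x y -> d x = d y.
  by rewrite adjE /d => /orP[]/eqP->; rewrite (inj_eq injf).
have d_conn (x y : spanning F) : connect (@adj (spanning F)) x y -> d x = d y.
  case/connectP => p; elim: p x => [|z p IHp] x /=; first by move=> _ ->.
  by case/andP=> /d_adj-> /IHp{}IHp /IHp.
move=> x; exists (d x); first by rewrite /d !inE; case: (_ != _).
move=> z; rewrite (d_conn x (val z)); last by have := valP z; rewrite inE.
rewrite /degree -(card_imset _ val_inj).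
have -> : val @: [set y : component x | adj z y] = [set f (val z); invF injf (val z)].
  apply/setP => y; rewrite !inE; apply/imsetP/orP.
    case=> y' ; rewrite inE => /[swap] ->; rewrite /adj /= /induced_adj /= adjE.
    case/orP; first by left.
    by move=> /eqP->; right; rewrite invF_f.
  move=> yE; have zy : spanning_adj F (val z) y.
    by rewrite adjE; case: yE => /eqP->; rewrite ?f_invF eqxx ?orbT.
  have yC : y \in [set y | connect (@adj (spanning F)) x y].
    have := valP z; rewrite !inE => /connect_trans; apply; exact: connect1.
  by exists (exist _ y yC) => //; rewrite inE.
rewrite cards2 /d; congr (_ : bool).+1; congr (~~ _).
by rewrite -[LHS](inj_eq injf) f_invF.
Qed.

(** For a Hall violator [X] with neighbourhood [W], a vertex of [X] outside [W] has no neighbour in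
    [X], so its neighbours lie in [W :\: X]; discarding the common part of [X] and [W] preserves the
    strict inequality. *)
Lemma factor_or_deficient (G : sgraph) : ~ has_12_factor G ->
  exists S I : {set G}, [/\ [disjoint S & I], #|S| < #|I| &
    forall x y, x \in I -> adj x y -> y \in S].
Proof.
move=> nofactor; pose N (x : G) := [set y | adj x y].
have [X XN] : exists X : {set G}, #|\bigcup_(x in X) N x| < #|X|.
  apply: contrapT => none; apply: nofactor.
  have [|f injf fN] := @hall _ N.
    by move=> X; rewrite leqNgt; apply/negP => h; apply: none; exists X.
  by apply: injective_12_factor injf _ => x; have := fN x; rewrite inE.
set W := \bigcup_(x in X) N x in XN.
have memW x y : x \in X -> adj x y -> y \in W.
  by move=> xX xy; apply/bigcupP; exists x; rewrite ?inE.
exists (W :\: X), (X :\: W); split.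
- by rewrite disjoint_sym disjoints_subset; apply/subsetP => x; rewrite !inE => /andP[/negbTE->] ->.
- by have := cardsID X W; have := cardsID W X; rewrite setIC; lia.
move=> x y; rewrite !inE => /andP[xW xX] xy; rewrite (memW x y) // andbT.
by apply: contra xW => yX; apply: memW yX _; rewrite adj_sym.
Qed.

Lemma min_degree_le (G : sgraph) (x : G) : min_degree G <= degree x.
Proof.
rewrite /min_degree; have : x \in index_enum G by rewrite mem_index_enum.
elim: index_enum => // y s IHs; rewrite inE big_cons geq_min => /orP[/eqP->|/IHs->].
  by rewrite leqnn.
by rewrite orbT.
Qed.

Lemma le_min_degree (G : sgraph) k :
  k <= #|G| -> (forall x : G, k <= degree x) -> k <= min_degree G.
Proof.
move=> kG kd; rewrite /min_degree; elim/big_ind: _ => // m n km kn.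
by rewrite leq_min km.
Qed.

(** If [x] had at most [k] neighbours, deleting them together with other vertices up to [k] in all
    would isolate [x], and an isolated vertex lies in no factor. *)
Lemma factor_critical_degree k (G : sgraph) (x : G) :
  factor_critical k G -> k < degree x.
Proof.
case=> kG crit; rewrite ltnNge; apply/negP => dk.
pose N := [set y | adj x y].
have [B BN cB] : exists2 B : {set G}, B \subset ~: (x |: N) & #|B| = k - #|N|.
  apply: subset_of_card; have := cardsC (x |: N).
  by rewrite cardsU1 inE adj_irr; move: kG dk; rewrite /degree -/N; lia.
have [|F _ F12] := crit (N :|: B).
  rewrite cardsU; have -> : N :&: B = set0.
    apply/setP => y; rewrite !inE; apply/negbTE/andP => -[xy /(subsetP BN)].
    by rewrite !inE xy orbT.
  by rewrite cards0 cB subn0 subnKC.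
have xD : x \in ~: (N :|: B).
  rewrite !inE adj_irr /=; apply/negP => /(subsetP BN); by rewrite !inE eqxx.
pose x' : delete_vertices (N :|: B) := exist _ x xD.
have [d d12 reg] := F12 x'.
have xC : (x' : spanning F) \in [set y | connect (@adj (spanning F)) x' y].
  by rewrite inE connect0.
pose x2 : component (x' : spanning F) :=
  exist (fun y : spanning F => y \in [set y | connect (@adj (spanning F)) x' y]) _ xC.
have d0 : 0 < degree x2.
  by rewrite reg; move: d12; rewrite !inE => /orP[]/eqP->.
case/card_gt0P: d0 => -[y yC]; rewrite inE => /andP[xy _].
by have := valP y; rewrite !inE; move: xy; rewrite /= /induced_adj /= => ->.
Qed.

(** The deleted set [T] is added to the deficient set [S'] of the remaining graph, and the isolated
    vertices are trimmed to [|S'| + 1] so that the count becomes an equality. *)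
Lemma deficient_delete_edge k (G : sgraph) (e : {set G}) :
  k < #|G| -> ~ factor_critical k (delete_edge e) ->
  exists S I : {set G}, [/\ [disjoint S & I], k <= #|S|, #|I| + k = #|S|.+1 &
    forall x y, x \in I -> adj x y -> [set x; y] != e -> y \in S].
Proof.
move=> kG ncrit.
have [T [Tk nofactor]] : exists T : {set G}, #|T| = k /\
    ~ has_12_factor (@delete_vertices (delete_edge e) T).
  apply: contrapT => none; apply: ncrit; split=> // T Tk; apply: contrapT => nf.
  by apply: none; exists T.
have [S' [I' [SI' cSI adjI]]] := factor_or_deficient nofactor.
pose S := T :|: val @: S'; pose I := val @: I'.
have cS : #|S| = k + #|S'|.
  rewrite cardsU Tk card_imset; last exact: val_inj.
  have -> : T :&: val @: S' = set0; last by rewrite cards0 subn0.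
  apply/setP => y; rewrite !inE; apply/negbTE/andP => -[yT /imsetP[z _ yz]].
  by have := valP z; rewrite -yz inE yT.
have cI : #|I| = #|I'| by rewrite card_imset //; apply: val_inj.
have [J JI cJ] : exists2 J : {set G}, J \subset I & #|J| = #|S'|.+1.
  by apply: subset_of_card; rewrite cI.
exists S, J; split.
- rewrite disjoint_sym disjoints_subset; apply/subsetP => x /(subsetP JI)/imsetP[z zI ->].
  rewrite !inE negb_or; have := valP z; rewrite inE => -> /=.
  by apply/imsetP => -[w wS /val_inj zw]; have := disjointFr SI' wS; rewrite -zw zI.
- by rewrite cS leq_addr.
- by rewrite cJ cS; lia.
move=> x y /(subsetP JI)/imsetP[z zI ->] zy zye.
rewrite inE; case: (boolP (y \in T)) => //= yT.
have yD : y \in ~: T by rewrite inE.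
apply/imsetP; exists (exist _ y yD) => //.
apply: adjI zI _; rewrite /adj /= /induced_adj /adj /= /spanning_adj zy /= !inE zye /=.
by apply/existsP; exists (val z); apply/existsP; exists y; rewrite zy eqxx.
Qed.

(* Discarding a heaviest element of a set does not increase its mean weight. *)
Lemma light_subset (T : finType) (w : T -> nat) (S : {set T}) k :
  k <= #|S| -> exists X : {set T}, [/\ X \subset S, #|X| = k &
    #|S| * \sum_(x in X) w x <= k * \sum_(x in S) w x].
Proof.
(* Induction on the number of discarded elements, [k] being renamed to that number. *)
move=> kS; rewrite -(subKn kS); move: (#|S| - k) (leq_subr k #|S|) => {kS}{}k.
elim: k => [|k IHk] kS; first by exists S; rewrite subn0.
have [X [XS cX wX]] := IHk (ltnW kS).
have [x0 x0X] : exists x, x \in X by apply/card_gt0P; rewrite cX; lia.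
have [x xX xmax] := @arg_maxnP _ x0 (fun y => y \in X) w x0X.
exists (X :\ x); split.
- by apply: subset_trans XS; apply: subsetDl.
- by have := cardsD1 x X; rewrite xX cX; lia.
have sumX : \sum_(y in X) w y = w x + \sum_(y in X :\ x) w y by rewrite (big_setD1 x).
have le_max : \sum_(y in X) w y <= #|X| * w x.
  by rewrite -sum_nat_const; apply: leq_sum => y /xmax.
move: wX le_max sumX; rewrite cX.
move: (\sum_(y in X) w y) (\sum_(y in X :\ x) w y) (\sum_(y in S) w y) (w x) => a b c u.
move=> h1 h2 h3; have [j Ej] : exists j, #|S| - k = j.+1 by exists (#|S| - k.+1); lia.
have -> : #|S| - k.+1 = j by lia.
rewrite Ej in h1 h2; rewrite -(leq_pmul2l (ltn0Sn j)).
(* The discarded weight [u] is at least the mean [a / j.+1]. *)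
have h4 : j.+1 * b <= j * a by nia.
apply: (@leq_trans (#|S| * (j * a))); first by rewrite mulnCA leq_mul2l h4 orbT.
by rewrite mulnCA [X in _ <= X]mulnCA leq_mul2l h1 orbT.
Qed.

(** * Edge counting *)

Lemma sum_induced (G : sgraph) (D A : {set G}) (F : G -> nat) : A \subset D ->
  \sum_(x : induced D | val x \in A) F (val x) = \sum_(x in A) F x.
Proof.
move=> AD; have -> : A = val @: [set x : induced D | val x \in A].
  apply/setP => x; apply/idP/imsetP => [xA|[y]]; last by rewrite inE => yA ->.
  by exists (exist _ x (subsetP AD x xA)); rewrite ?inE.
rewrite big_imset /=; last by move=> x y _ _; apply: val_inj.
by apply: eq_bigl => x; rewrite mem_imset //; apply: val_inj.
Qed.

Lemma planar_induced_bound (R : realType) (G : sgraph) (D A B : {set G}) :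
  planar R (induced D) -> A \subset D -> B \subset D ->
  [disjoint A & B] -> 3 <= #|A| + #|B| -> edge_count A B + 4 <= 2 * (#|A| + #|B|).
Proof.
move=> pl AD BD AB AB3.
pose pre (X : {set G}) := [set x : induced D | val x \in X].
have card_pre (X : {set G}) : X \subset D -> #|pre X| = #|X|.
  by move=> XD; rewrite cardsE -sum1_card -[RHS]sum1_card -(sum_induced _ XD).
have dis : [disjoint pre A & pre B].
  by rewrite disjoints_subset; apply/subsetP => x; rewrite !inE => xA; rewrite (disjointFr AB).
have := planar_bipartite_bound pl dis; rewrite !card_pre // => /(_ AB3); apply: leq_trans.
rewrite leq_add2r /edge_count -(sum_induced _ AD) big_mkcond [X in _ <= X]big_mkcond.
apply: leq_sum => x _; rewrite inE; case: ifP => // _.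
by rewrite -(sum_induced _ BD); apply: eq_leq; apply: eq_bigl => y; rewrite inE.
Qed.

(** Only [e] can leave [I] without ending in [S], and it costs at most one neighbour at each of its
    two ends. *)
Lemma edge_count_lower (G : sgraph) (S I e : {set G}) d :
  (forall x : G, d <= degree x) -> e \in edges G ->
  (forall x y, x \in I -> adj x y -> [set x; y] != e -> y \in S) ->
  d * #|I| <= edge_count I S + 2.
Proof.
move=> dd; rewrite inE => /existsP[a /existsP[b /andP[ab /eqP ->{e}]]] IS.
apply: (@leq_trans (\sum_(x in I) (\sum_(y in S) adj x y + (x \in [set a; b])))).
  rewrite mulnC -sum_nat_const; apply: leq_sum => x xI; apply: leq_trans (dd x) _.
  rewrite /degree -sum1_card.
  have -> : \sum_(y in S) adj x y = #|[set y in S | adj x y]|.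
    rewrite -sum1_card [RHS]big_mkcond [LHS]big_mkcond; apply: eq_bigr => y _.
    by rewrite inE; case: (y \in S); case: (adj x y).
  rewrite sum1_card.
  have sub : [set y | adj x y] \subset
      [set y in S | adj x y] :|: [set y | adj x y & [set x; y] == [set a; b]].
    apply/subsetP => y; rewrite !inE => xy; rewrite xy andbT /=.
    by have := IS x y xI xy; case: eqP => _; rewrite ?orbT ?orbF // => ->.
  apply: leq_trans (subset_leq_card sub) _; apply: leq_trans (leq_card_setU _ _).1 _.
  rewrite leq_add2l; case: (boolP (x \in [set a; b])) => xab.
    apply/card_le1_eqP => y z; rewrite !inE => /andP[xy /eqP yab] /andP[xz /eqP zab].
    have : y \in [set x; z] by rewrite zab -yab !inE eqxx orbT.
    by rewrite !inE => /orP[]/eqP // yx; rewrite yx adj_irr in xy.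
  rewrite leqn0 cards_eq0; apply/eqP/setP => y; rewrite !inE; apply/negbTE.
  by apply: contra xab => /andP[_ /eqP <-]; rewrite !inE eqxx.
rewrite big_split /= leq_add2l; apply: (@leq_trans #|[set a; b]|).
  rewrite -sum1_card big_mkcond [X in _ <= X]big_mkcond; apply: leq_sum => x _.
  by case: (x \in I); case: (x \in _).
by rewrite cards2; case: (_ != _).
Qed.

Lemma edge_countC (G : sgraph) (A B : {set G}) : edge_count A B = edge_count B A.
Proof.
rewrite /edge_count exchange_big; apply: eq_bigr => y _; apply: eq_bigr => x _.
by rewrite adj_sym.
Qed.

Lemma edge_count_le (G : sgraph) (A B : {set G}) : edge_count A B <= #|A| * #|B|.
Proof.
rewrite -sum_nat_const; apply: leq_sum => x _; rewrite -sum1_card.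
by apply: leq_sum => y _; apply: leq_b1.
Qed.

(** * The minimum degree bounds *)

Theorem theorem8 (R : realType) (k : nat) (G : sgraph)
    (hG : factor_critical k G)
    (he : exists2 e : {set G}, e \in edges G &
            ~ factor_critical k (delete_edge e)) :
  (k = 0 -> planar R G -> k + 1 <= min_degree G <= k + 3) /\
  (0 < k -> k_planar R k G -> k + 1 <= min_degree G <= k + 2).
Proof.
have low : k + 1 <= min_degree G.
  rewrite addn1; apply: le_min_degree => [|x]; first by case: hG.
  exact: factor_critical_degree.
case: he => e eG /(deficient_delete_edge hG.1)[S [I [SI kS cI IS]]].
have IS' : [disjoint I & S] by rewrite disjoint_sym.
have EIS := edge_count_le I S.
rewrite low; split=> [k0 pl|k0 pl] /=; rewrite leqNgt; apply/negP => big.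
  (* As [|I| = |S| + 1], planarity allows at most [2 (|I| + |S|) - 4 = 4 |I| - 6] edges between [I]
     and [S], fewer than the [4 |I| - 2] forced by minimum degree four. *)
  have lower : 4 * #|I| <= edge_count I S + 2.
    by apply: edge_count_lower eG IS => x; apply: leq_trans (min_degree_le x); lia.
  have [S0|Spos] := posnP #|S|; first by move: EIS; rewrite S0; lia.
  have three : 3 <= #|I| + #|S| by lia.
  by have := planar_bipartite_bound pl IS' three; lia.
have lower : (k + 3) * #|I| <= edge_count I S + 2.
  by apply: edge_count_lower eG IS => x; apply: leq_trans (min_degree_le x); lia.
have [X [XS cX wX]] := light_subset (fun y => \sum_(x in I) adj y x) kS.
have cS : #|S| = k + #|S :\: X| by rewrite -(cardsID X S) (setIidPr XS) cX.
have split_count : edge_count I S = edge_count I X + edge_count I (S :\: X).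
  by rewrite !(edge_countC I) /edge_count (big_setID X) /= (setIidPr XS).
rewrite -!/(edge_count _ I) -!(edge_countC I) in wX.
(* If [X] is all of [S], then [|S| = k] and [|I| = 1], leaving at most [k] edges where [k + 1] are
   required. *)
have [t0|tpos] := posnP #|S :\: X|.
  by move: EIS; rewrite cS t0; nia.
have IX : I \subset ~: X by rewrite -disjoints_subset (disjointWr XS IS').
have SX : S :\: X \subset ~: X by rewrite setDE subsetIr.
have ISX := disjointWr (subsetDl S X) IS'.
have three : 3 <= #|I| + #|S :\: X| by lia.
have := planar_induced_bound (pl X cX) IX SX ISX three.
move: wX lower; rewrite split_count cS.
have -> : #|I| = #|S :\: X|.+1 by lia.
move: (edge_count I X) (edge_count I (S :\: X)) #|S :\: X| tpos => a b t t0.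
move=> h1 h2 h3.
(* Lightness of [X] amounts to [t a <= k b]. Together with [a + b >= (k + 3) (t + 1) - 2] and
   [b <= 4 t - 2] it gives [(k - 1) (t - 1) (t - 2) + 2 <= 0], which is impossible; the
   substitutions below make the factors visibly nonnegative. *)
have h4 : t * (a + b) <= (k + t) * b by nia.
have [j Ek] : exists j, k = j.+1 by exists k.-1; lia.
have [t1|[u tu]] : t = 1 \/ exists u, t = u.+2.
- by case: (t) t0 => [|[|u]] // _; [left | right; exists u].
- by subst t k; nia.
- subst t k; nia.
Qed.
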